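(* If $n\ge 4$ is an integer, then $$\frac{5n^2-8n}{21}\ \ge\ \operatorname{ar}(n,F_4)\ \ge\ m(n)+1 .$$ Moreover, if $n=2^s-1$ for some integer $s\ge 3$, then $$\operatorname{ar}(n,F_4)\ \ge\ m(n)+\frac{n^2}{42}+o(n^2)=\frac{4}{21}n^2+o(n^2),$$ where the $o(n^2)$ terms are as $s\to\infty$ (along $n=2^s-1$).
   Context: $F_4$ is the $3$-uniform hypergraph $\{abc,abd,bcd\}$ on four distinct vertices $a,b,c,d$. $K_n^{(3)}$ is the complete $3$-uniform hypergraph on $n$ vertices. An edge-coloring is a surjection from the edge set onto a set of colors; a copy of $F_4$ is rainbow if its three edges receive pairwise distinct colors. $\operatorname{ar}(n,F_4)$ is the maximum number of colors in an edge-coloring of $K_n^{(3)}$ containing no rainbow copy of $F_4$. A partial Steiner triple system of order $n$ is a family of $3$-subsets (triples) of an $n$-set such that every pair of elements is contained in at most one triple of the family; $m(n)$ denotes the maximum number of triples in a partial Steiner triple system of order $n$. *)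

(* Defs.v *)
From mathcomp Require Import all_boot.

Set Implicit Arguments.
Unset Strict Implicit.
Unset Printing Implicit Defensive.

Definition triples (n : nat) : {set {set 'I_n}} := [set e : {set 'I_n} | #|e| == 3].

(* Only the values of c on triples n matter; c is total on {set 'I_n} for
   convenience. *)
Definition edge_coloring (n k : nat) (c : {ffun {set 'I_n} -> 'I_k}) : bool :=
  c @: triples n == [set: 'I_k].

Definition rainbow_F4 (n k : nat) (c : {ffun {set 'I_n} -> 'I_k})
    (x y z t : 'I_n) : bool :=
  uniq [:: x; y; z; t] &&
  uniq [:: c [set x; y; z]; c [set x; y; t]; c [set y; z; t]].

Definition has_rainbow_F4 (n k : nat) (c : {ffun {set 'I_n} -> 'I_k}) : bool :=
  [exists x, exists y, exists z, exists t, rainbow_F4 c x y z t].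

Definition rainbow_F4_free_colorable (n k : nat) : bool :=
  [exists c : {ffun {set 'I_n} -> 'I_k},
    edge_coloring c && ~~ has_rainbow_F4 c].

(* The range loses nothing: an edge-coloring has at most 'C(n, 3) colors, see
   ar_F4_max. *)
Definition ar_F4 (n : nat) : nat :=
  \max_(k < 'C(n, 3).+1 | rainbow_F4_free_colorable n k) k.

Definition partial_STS (n : nat) (S : {set {set 'I_n}}) : bool :=
  (S \subset triples n) &&
  [forall x, forall y, (x != y) ==>
    (#|[set B in S | (x \in B) && (y \in B)]| <= 1)].

Definition max_partial_STS (n : nat) : nat :=
  \max_(S : {set {set 'I_n}} | partial_STS S) #|S|.

Lemma card_triples (n : nat) : #|triples n| = 'C(n, 3).
Proof. by rewrite card_draws card_ord. Qed.

Lemma ar_F4_max (n k : nat) : rainbow_F4_free_colorable n k -> k <= ar_F4 n.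
Proof.
move=> kP; have lek : k < 'C(n, 3).+1.
  case/existsP: kP => c /andP[/eqP imc _].
  by rewrite ltnS -card_triples -[k in k <= _]card_ord -cardsT -imc leq_imset_card.
exact: (@leq_bigmax_cond _ _ (fun i : 'I_('C(n, 3).+1) => nat_of_ord i)
          (Ordinal lek) kP).
Qed.

Lemma ar_F4_attained (n : nat) :
  3 <= n -> rainbow_F4_free_colorable n (ar_F4 n).
Proof.
move=> n3; have C0 : 0 < 'C(n, 3) by rewrite bin_gt0.
have one : rainbow_F4_free_colorable n (Ordinal (C0 : 1 < 'C(n, 3).+1)).
  apply/existsP; exists [ffun=> ord0]; apply/andP; split.
    have [e eT] : exists e, e \in triples n by apply/card_gt0P; rewrite card_triples.
    apply/eqP/setP=> i; rewrite inE ord1; apply/imsetP; exists e => //.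
    by rewrite ffunE.
  apply/negP => /existsP[x /existsP[y /existsP[z /existsP[t /andP[_]]]]].
  by rewrite !ffunE.
have [|i iP eqi] := @eq_bigmax_cond _
  [pred k : 'I_('C(n, 3).+1) | rainbow_F4_free_colorable n k]
  (fun k => nat_of_ord k).
  by apply/card_gt0P; exists (Ordinal (C0 : 1 < 'C(n, 3).+1)).
have -> : ar_F4 n = i by exact: eqi.
exact: iP.
Qed.

(* Main.v *)
Require Import Defs.
From mathcomp Require Import all_boot zify.
Set Implicit Arguments.
Unset Strict Implicit.
Unset Printing Implicit Defensive.

(** A coloring of the triples has no rainbow [F_4] exactly when every four
    vertices see at most two colors.

    Upper bound.  Write [v_A] for the number of vertices covered by the edges
    of color [A].  The colors at a vertex [x] form a Gallai coloring of the
    pairs of the other [n - 1] vertices (no rainbow triangle), so there are at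
    most [n - 2] of them ([colors_at_vertex]) and the [v_A] sum to at most
    [n * (n - 2)].  This settles colors with [v_A >= 7]; a smaller color lacks
    [7 - v_A], and the deficits are charged to pairs of vertices
    ([sum_small_span]): together they amount to at most 4/3 per pair.  An
    isolated edge, whose deficit 4 is spread over its own three pairs, is the
    tight case.  As [21 = 3 * v_A + 3 * (7 - v_A)] for small colors, this gives
    21 times the number of colors at most
    [3 * n * (n - 2) + 2 * n * (n - 1) = 5 * n ^ 2 - 8 * n].

    The charging uses an optimal coloring: with the most colors and, among
    those, the most colors that have a single edge.  Then each color is
    connected through pairs shared by its edges, since otherwise a part could
    receive a new color.  Hence a vertex [w] that color [A] does not cover sees
    all pairs of the shadow of [A] in one color [B] ([uniform_shadow]); then
    [B] lies above [A], covering the shadow of [A] and more.  Two small colors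
    at one pair are either comparable in this sense, or each covers the edges
    of the other at that pair; the latter bounds the number of minimal colors
    at a pair ([payers_bound]).  Each pair splits its charge evenly among the
    minimal colors there, and the lemmas [total_pay_minimal] and
    [total_pay_over_span3], [total_pay_over_span4], [total_pay_over_span5]
    show that a small color collects enough.

    Lower bounds.  Any two triples among four points share a pair, so in a
    partial Steiner system whose triples get private colors, all other triples
    sharing one more color, at most one of the four has a private color.  More
    colors come from placing Fano planes on 7-point blocks that pairwise meet in
    at most one point: each line has a private color, and the other triples of a
    block share a color of the block ([block_coloring_free]).  With [q] blocks
    this gives [8 * q] colors and a partial Steiner system of [7 * q] triples.
    Transversal designs on [7 * N] points, applied recursively inside the
    groups, give [q = n ^ 2 / 42 - O(n log n)] ([exists_packing]); and
    [m(n) <= n * (n - 1) / 6] by counting pairs. *)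

(** * Colorings of triples *)

Lemma uniq4P (T : eqType) (x y z t : T) :
  reflect [/\ [/\ x != y, x != z & x != t], y != z, y != t & z != t]
          (uniq [:: x; y; z; t]).
Proof.
rewrite /= !inE !negb_or !andbT -!andbA.
apply: (iffP idP) => [/and5P[-> -> -> -> /andP[-> ->]]|[[-> -> ->] -> -> ->]] //.
Qed.

Lemma card_set3 (V : finType) (x y z : V) :
  x != y -> x != z -> y != z -> #|[set x; y; z]| = 3.
Proof. by move=> xy xz yz; rewrite -setUA cardsU1 cards2 !inE negb_or xy xz yz. Qed.

Section Coloring.

Variables (V K : finType) (c : {set V} -> K).
Implicit Types (x y z t w : V) (A B C : K) (S : {set V}).

Local Notation T x y z := (c [set x; y; z]).

Definition F4_free := forall x y z t, uniq [:: x; y; z; t] ->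
  ~~ uniq [:: T x y z; T x y t; T y z t].

Definition edge A x y z := [&& x != y, x != z, y != z & T x y z == A].

Definition span A : {set V} := [set x | [exists y, exists z, edge A x y z]].

Definition link A x y : {set V} := [set z | edge A x y z].

Definition shadow A x y := link A x y != set0.

Lemma color21 x y z : T x y z = T y x z.
Proof. by rewrite (setUC [set x]). Qed.

Lemma color132 x y z : T x y z = T x z y.
Proof. by rewrite setUAC. Qed.

Lemma edge21 A x y z : edge A x y z = edge A y x z.
Proof. by rewrite /edge color21 (eq_sym x y); do !bool_congr. Qed.

Lemma edge132 A x y z : edge A x y z = edge A x z y.
Proof. by rewrite /edge color132 (eq_sym y z); do !bool_congr. Qed.

Lemma edge_neq A x y z : edge A x y z -> [/\ x != y, x != z & y != z].
Proof. by case/and4P. Qed.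

Lemma edgeE A x y z : edge A x y z -> T x y z = A.
Proof. by case/and4P => _ _ _ /eqP. Qed.

Lemma edge_color x y z : x != y -> x != z -> y != z -> edge (T x y z) x y z.
Proof. by move=> xy xz yz; apply/and4P; split. Qed.

Lemma mem_span A x y z : edge A x y z -> x \in span A.
Proof. by move=> e; rewrite inE; apply/existsP; exists y; apply/existsP; exists z. Qed.

Lemma mem_span2 A x y z : edge A x y z -> y \in span A.
Proof. by rewrite edge21; apply: mem_span. Qed.

Lemma mem_span3 A x y z : edge A x y z -> z \in span A.
Proof. by rewrite edge132; apply: mem_span2. Qed.

Lemma spanP A x : reflect (exists y z, edge A x y z) (x \in span A).
Proof.
rewrite inE; apply: (iffP existsP) => [[y /existsP[z e]]|[y [z e]]].
  by exists y, z.
by exists y; apply/existsP; exists z.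
Qed.

Lemma shadowP A x y : reflect (exists z, edge A x y z) (shadow A x y).
Proof.
by apply: (iffP (set0Pn _)) => -[z e]; exists z; rewrite inE in e *.
Qed.

Lemma edge_shadow A x y z : edge A x y z -> shadow A x y.
Proof. by move=> e; apply/shadowP; exists z. Qed.

Lemma shadowC A x y : shadow A x y = shadow A y x.
Proof. by apply/shadowP/shadowP => -[z e]; exists z; rewrite edge21. Qed.

Lemma edge_shadows A x y z : edge A x y z ->
  [/\ shadow A x y, shadow A x z & shadow A y z].
Proof.
move=> e; split; first exact: (edge_shadow e).
  by rewrite edge132 in e; apply: (edge_shadow e).
by rewrite edge21 edge132 in e; apply: (edge_shadow e).
Qed.

Lemma shadow_span A x y : shadow A x y -> x \in span A.
Proof. by case/shadowP => z /mem_span. Qed.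

Lemma shadow_neq A x y : shadow A x y -> x != y.
Proof. by case/shadowP => z /edge_neq[]. Qed.

Lemma edge_subset_span A x y z : edge A x y z -> [set x; y; z] \subset span A.
Proof.
move=> e; apply/subsetP => u /setUP[/set2P[]|/set1P] ->.
- exact: (mem_span e).
- exact: (mem_span2 e).
- exact: (mem_span3 e).
Qed.

Lemma card_edge A x y z : edge A x y z -> #|[set x; y; z]| = 3.
Proof.
by case/edge_neq; exact: card_set3.
Qed.

Lemma span_single A x y z : edge A x y z -> #|span A| = 3 -> span A = [set x; y; z].
Proof.
move=> e A3; apply/esym/eqP; rewrite eqEcard edge_subset_span //=.
by rewrite A3 (card_edge e).
Qed.

Hypothesis free : F4_free.

(** The definition of [F4_free] leaves out one of the four triples on
    [x, y, z, t]; as any three of them meet in a vertex, it says the same about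
    every choice of three. *)
Lemma color_star x y z t : uniq [:: x; y; z; t] -> T x y z != T x y t ->
  T x z t = T x y z \/ T x z t = T x y t.
Proof.
move=> u ne; have u' : uniq [:: y; x; z; t].
  by rewrite -(perm_uniq (s1 := [:: x; y; z; t])) // (perm_catCA [:: x] [:: y]).
move: (free u'); rewrite /= !inE negb_or !(color21 y x) ne /= andbT negb_and !negbK.
by case/orP => /eqP ->; [left | right].
Qed.

(** * Charging small colors to pairs of vertices *)

(** [lower A B] asks for a single pair of the shadow of [A], but by [uniform]
    the vertex [t] then sees the whole shadow in color [B]: the shadow of [B]
    contains the cone with apex [t] over that of [A]. *)
Definition lower A B :=
  [exists x, exists y, exists t, [&& shadow A x y, t \notin span A & edge B x y t]].

(** Restricting to colors that are minimal at the pair [x, y] makes any two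
    payers there incomparable, which is what bounds their number. *)
Definition pays B x y :=
  [&& #|span B| <= 6, shadow B x y &
      ~~ [exists A, lower A B && shadow A x y]].

Definition payers x y : {set K} := [set B | pays B x y].

(** The number of payers is at most 4 (see [payers_bound]), and 12 is a common
    multiple of 1, 2, 3, 4, so that no share is lost to rounding. *)
Definition pay B x y : nat := if pays B x y then 12 %/ #|payers x y| else 0.

Lemma paysC B x y : pays B x y = pays B y x.
Proof.
rewrite /pays (shadowC B); do 2!bool_congr.
by congr (~~ _); apply: eq_existsb => A; rewrite (shadowC A).
Qed.

Lemma payC B x y : pay B x y = pay B y x.
Proof.
rewrite /pay paysC; congr (if _ then 12 %/ _ else 0).
by apply: eq_card => A; rewrite !inE paysC.
Qed.

Lemma pay_diag B x : pay B x x = 0.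
Proof.
by rewrite /pay; case: ifP => // /and3P[_ /shadow_neq]; rewrite eqxx.
Qed.

Lemma sum_pay x y : \sum_B pay B x y <= 12 * (x != y).
Proof.
have [-> | xy] := eqVneq x y; first by rewrite big1 // => B _; exact: pay_diag.
rewrite -big_mkcond /= (eq_bigl (mem (payers x y))); last by move=> B; rewrite !inE.
by rewrite sum_nat_const mulnC leq_trunc_div.
Qed.

Lemma sum_pay_all : \sum_B \sum_x \sum_y pay B x y <= 12 * (#|V| * #|V|.-1).
Proof.
rewrite exchange_big /=; under eq_bigr do rewrite exchange_big /=.
have -> : 12 * (#|V| * #|V|.-1) = \sum_(x : V) \sum_(y : V) 12 * (x != y).
  transitivity (\sum_(x : V) 12 * #|V|.-1).
    by rewrite sum_nat_const mulnCA.
  apply: eq_bigr => x _; rewrite -big_distrr /=; congr (_ * _).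
  rewrite (bigD1 x) //= eqxx add0n.
  rewrite (eq_bigr (fun=> 1)) => [|y /negPf]; last by rewrite eq_sym => ->.
  by rewrite sum1_card cardC1.
by apply: leq_sum => x _; apply: leq_sum => y _; exact: sum_pay.
Qed.

(** [uniform], [grow] and, further down, [four] hold in an optimal coloring. *)
Hypothesis uniform : forall A w x y x' y', w \notin span A ->
  shadow A x y -> shadow A x' y' -> T x y w = T x' y' w.

Hypothesis grow : forall A S,
  (exists x y z, edge A x y z /\ [set x; y; z] \subset S) ->
  ~~ (span A \subset S) ->
  exists x y z w, [/\ edge A x y z, [set x; y; z] \subset S,
                      edge A x y w & w \notin S].

(** One apex serves the whole shadow because [t] sees all of it in the same
    color. *)
Lemma lower_apex A B : lower A B ->
  exists2 t, t \notin span A & forall x y, shadow A x y -> edge B x y t.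
Proof.
case/existsP=> x0 /existsP[y0 /existsP[t /and3P[s0 tA /edgeE <-]]].
exists t => // x y sxy; rewrite (uniform tA s0 sxy).
have ne z : z \in span A -> z != t by apply: contraTneq => ->.
apply: edge_color; first exact: shadow_neq sxy.
  exact/ne/(shadow_span sxy).
by apply/ne; move: sxy; rewrite shadowC; apply: shadow_span.
Qed.

Lemma span_shadow A x : x \in span A -> exists y, shadow A x y.
Proof. by case/spanP => y [z /edge_shadow sh]; exists y. Qed.

Lemma lower_proper A B : lower A B -> span A \proper span B.
Proof.
move=> AB; have [t tA apex] := lower_apex AB.
have [u uA] : exists u, u \in span A.
  by case/existsP: AB => x /existsP[y /existsP[z /and3P[/shadow_span]]]; exists x.
apply/properP; split.
  by apply/subsetP => x /span_shadow[y /apex/mem_span].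
by exists t => //; have [v /apex/mem_span3] := span_shadow uA.
Qed.

Lemma lower_irr A B : lower A B -> A != B.
Proof. by move/lower_proper; apply: contraTneq => ->; rewrite properxx. Qed.

(** If [A] also pays at [x, y], a vertex [z] of an edge [xyz] of color [A] lies
    in [span B], since otherwise [B] would be lower than [A].  Different payers
    have different such [z], and none of these lies in [link B x y]. *)
Lemma payers_bound B x y : pays B x y ->
  #|payers x y| <= #|span B :\: (x |: (y |: link B x y))|.+1.
Proof.
move=> payB; have /and3P[_ shB noB] := payB.
rewrite (cardsD1 B) inE payB ltnS.
set D := span B :\: _.
apply: leq_trans (leq_imset_card (fun z => T x y z) D); apply/subset_leq_card/subsetP.
move=> A /setD1P[AB]; rewrite inE => /and3P[_ /shadowP[z e] noA].
apply/imsetP; exists z; last by rewrite (edgeE e).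
have [xy xz yz] := edge_neq e.
apply/setDP; split; last first.
  rewrite !in_setU1 (eq_sym z x) (eq_sym z y) (negPf xz) (negPf yz) /=.
  by rewrite inE; apply: contra AB => /edgeE; rewrite (edgeE e) => ->.
apply: contraNT noA => zB; apply/existsP; exists B; rewrite shB andbT.
by apply/existsP; exists x; apply/existsP; exists y; apply/existsP; exists z; rewrite shB zB.
Qed.

(** Here [S] bounds the vertices of [span B] that the pair [t, a] might join in
    a color other than [B]; few such vertices leave few other payers. *)
Lemma pay_ge B t a S : #|span B| <= 6 -> shadow B t a ->
    (forall x, x \in span B -> x != t -> x != a -> x \in S \/ T t a x = B) ->
    (forall x, x \in S -> ~~ lower (T t a x) B) ->
  12 %/ #|S|.+1 <= pay B t a.
Proof.
move=> B6 sh cov noS.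
have payB : pays B t a.
  rewrite /pays B6 sh /=; apply/existsP => -[A /andP[AB /shadowP[x e]]].
  have xB : x \in span B.
    exact: (subsetP (proper_sub (lower_proper AB)) _ (mem_span3 e)).
  have [_ tx ax] := edge_neq e.
  have [xS|TB] : x \in S \/ T t a x = B by apply: cov => //; rewrite eq_sym.
    by have := noS x xS; rewrite (edgeE e) AB.
  by have := lower_irr AB; rewrite -(edgeE e) TB eqxx.
have n0 : 0 < #|payers t a| by apply/card_gt0P; exists B; rewrite inE.
rewrite /pay payB; apply: leq_div2l => //; apply: leq_trans (payers_bound payB) _.
rewrite ltnS; apply/subset_leq_card/subsetP => x /setDP[xB].
rewrite !in_setU1 !negb_or => /and3P[xt xa]; rewrite inE => xL.
have [//|TB] := cov x xB xt xa; case/negP: xL.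
by rewrite -TB; apply: edge_color; rewrite 1?(eq_sym _ x) ?(shadow_neq sh).
Qed.

(** The factor 2 comes from summing over ordered pairs. *)
Lemma sum_pay_apex B t (s : seq V) : uniq s ->
  2 * (\sum_(a <- s) pay B t a) <= \sum_x \sum_y pay B x y.
Proof.
move=> us; rewrite (bigD1 t) //= mul2n -addnn.
have le_s : \sum_(a <- s) pay B t a <= \sum_a pay B t a.
  by rewrite big_uniq //= [leqRHS](bigID (mem s)) leq_addr.
apply: leq_add => //; apply: leq_trans le_s _.
rewrite (bigD1 t) //= pay_diag add0n; apply: leq_sum => x _.
by rewrite (bigD1 t) //= (payC B x) leq_addr.
Qed.

(** Tight growth from an edge [xyz] first adds an edge [xyw], after which [x]
    and [y] both dominate the four points.  The fifth vertex [u] is attached to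
    a shadow pair: if that pair contains [x] or [y], this vertex still
    dominates; otherwise the pair is [zw], so all pairs of the four points are
    in the shadow and [z] dominates. *)
Lemma dominating_vertex A : #|span A| = 5 ->
  exists2 d, d \in span A & forall x, x \in span A -> x != d -> shadow A d x.
Proof.
move=> A5.
have [u0 [x0 [y0 e0]]] : exists u v w, edge A u v w.
  have /card_gt0P[u /spanP[v [w e]]] : 0 < #|span A| by rewrite A5.
  by exists u, v, w.
have [||x [y [z [w [exyz sub exyw]]]]] := @grow A [set u0; x0; y0].
- by exists u0, x0, y0.
- by apply/negP => /subset_leq_card; rewrite A5 (card_edge e0).
move/(contra (subsetP sub w)) => wS {u0 x0 y0 e0 sub}.
have [||p [q [r [u [epqr pqrS epqu uS]]]]] := @grow A (w |: [set x; y; z]).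
- by exists x, y, z; split=> //; exact: subsetUr.
- by apply/negP => /subset_leq_card; rewrite A5 cardsU1 wS (card_edge exyz).
have defA : span A = u |: (w |: [set x; y; z]).
  apply/esym/eqP; rewrite eqEcard A5 !cardsU1 uS wS (card_edge exyz) andbT.
  rewrite !subUset !sub1set (mem_span3 epqu) (mem_span3 exyw).
  by rewrite (mem_span exyz) (mem_span2 exyz) (mem_span3 exyz).
have pS : p \in w |: [set x; y; z] by apply: (subsetP pqrS); rewrite !inE eqxx.
have qS : q \in w |: [set x; y; z] by apply: (subsetP pqrS); rewrite !inE eqxx orbT.
have [sxy sxz syz] := edge_shadows exyz.
have [_ sxw syw] := edge_shadows exyw.
have [spq spu squ] := edge_shadows epqu.
pose dominates d := [/\ x != d -> shadow A d x, y != d -> shadow A d y,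
  z != d -> shadow A d z, w != d -> shadow A d w & shadow A d u].
suff [d dA [dx dy dz dw du]] : exists2 d, d \in span A & dominates d.
  exists d => // v; rewrite {1}defA => /setU1P[-> //|/setU1P[-> //|]].
  by case/setUP => [/set2P[]|/set1P] ->.
have sxu_dom : shadow A x u -> exists2 d, d \in span A & dominates d.
  by exists x; [exact: (mem_span exyz) | rewrite /dominates eqxx].
have syu_dom : shadow A y u -> exists2 d, d \in span A & dominates d.
  by exists y; [exact: (mem_span2 exyz) | rewrite /dominates eqxx (shadowC A y x)].
have szw_dom : shadow A z w -> shadow A z u -> exists2 d, d \in span A & dominates d.
  by exists z; [exact: (mem_span3 exyz) | rewrite /dominates eqxx (shadowC A z x) (shadowC A z y)].
have npq := shadow_neq spq.
case/setU1P: pS => [Ep|/setUP[/set2P[]|/set1P]Ep]; subst p; auto.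
- case/setU1P: qS => [Eq|/setUP[/set2P[]|/set1P]Eq]; subst q; auto.
  + by rewrite eqxx in npq.
  + by apply: szw_dom; rewrite // shadowC.
case/setU1P: qS => [Eq|/setUP[/set2P[]|/set1P]Eq]; subst q; auto.
by rewrite eqxx in npq.
Qed.

Definition total_pay B := \sum_x \sum_y pay B x y.

(** A color with nothing below it pays at every pair of its shadow, and each of
    its vertices lies in at least two such pairs. *)
Lemma total_pay_minimal B : (forall A, ~~ lower A B) -> #|span B| <= 6 ->
  #|span B| * (2 * (12 %/ (#|span B| - 2))) <= total_pay B.
Proof.
move=> noA B6.
have row x : x \in span B -> 2 * (12 %/ (#|span B| - 2)) <= \sum_y pay B x y.
  case/spanP => y [z e]; have [xy xz yz] := edge_neq e.
  have le_pay u v : edge B x u v -> 12 %/ (#|span B| - 2) <= pay B x u.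
    move=> e'; have le3 := edge_subset_span e'.
    have -> : #|span B| - 2 = #|span B :\: [set x; u; v]|.+1.
      have := subset_leq_card le3; rewrite cardsDS // (card_edge e').
      by move: #|span B|; clear; lia.
    apply: pay_ge (edge_shadow e') _ _ => // w wB wx wu.
    have [->|wv] := eqVneq w v; first by right; exact: edgeE e'.
    by left; rewrite !(in_setD, in_setU, in_set1) wB (negPf wx) (negPf wu) (negPf wv).
  rewrite mul2n -addnn (bigD1 y) //= (bigD1 z) 1?eq_sym //=.
  apply: leq_add; first exact: (le_pay _ _ e).
  by apply: leq_trans (leq_addr _ _); rewrite (le_pay z y) // edge132.
rewrite -sum_nat_const /total_pay [leqRHS](bigID (mem (span B))) /=.
by apply: leq_trans (leq_addr _ _); apply: leq_sum.
Qed.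

(** Without this, three colors of the form [{abc, abd}], placed cyclically on
    three pairs of vertices, would block every shadow pair of a color that
    covers the same six vertices. *)
Hypothesis four : forall B, #|span B| = 4 ->
  exists2 A, lower A B & #|span A| = 3.

(** By [four], a color on four vertices contains the cone over a single edge. *)
Lemma complete_shadow A : 3 <= #|span A| <= 4 ->
  {in span A &, forall a b, a != b -> shadow A a b}.
Proof.
have complete3 D : #|span D| = 3 ->
    {in span D &, forall a b, a != b -> shadow D a b}.
  move=> D3; have /card_gt0P[x /spanP[y [z e]]] : 0 < #|span D| by rewrite D3.
  have [sxy sxz syz] := edge_shadows e.
  rewrite (span_single e D3) => a b /setUP[/set2P[]|/set1P] -> /setUP[/set2P[]|/set1P] -> //;
    by rewrite ?eqxx // shadowC.
rewrite leq_eqVlt => /andP[/orP[/eqP/esym/complete3 //|A3 A4]].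
have {A3 A4} A4 : #|span A| = 4 by lia.
have [D DA D3] := four A4; have [t tD apex] := lower_apex DA.
have defA : span A = t |: span D.
  apply/esym/eqP; rewrite eqEcard cardsU1 tD D3 A4 leqnn andbT subUset sub1set.
  rewrite (proper_sub (lower_proper DA)) andbT.
  have /card_gt0P[x /span_shadow[y /apex/mem_span3]//] : 0 < #|span D| by rewrite D3.
have st a : a \in span D -> shadow A a t.
  by case/span_shadow => y /apex/edge_shadows[].
move=> a b; rewrite defA => /setU1P[->|aD] /setU1P[->|bD]; rewrite ?eqxx // => ab.
- by rewrite shadowC st.
- exact: st.
by have /apex/edge_shadows[] := complete3 D D3 a b aD bD ab.
Qed.

(** In this section [B] is a small color above [A], with apex [t].  The pairs
    [t, a] with [a] in [span A] have codegree at least 2 in [B], hence few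
    competing payers; they alone collect enough.  The set [R] consists of the
    vertices of [span B] outside the cone. *)
Section Apex.

Variables (A B : K) (t : V).
Hypotheses (AB : lower A B) (tA : t \notin span A).
Hypothesis apex : forall x y, shadow A x y -> edge B x y t.
Hypothesis B6 : #|span B| <= 6.

Local Notation R := (span B :\: (t |: span A)).

Lemma card_rest : #|span B| = #|R| + #|span A| + 1.
Proof.
have sub : t |: span A \subset span B.
  rewrite subUset sub1set (proper_sub (lower_proper AB)) andbT.
  by case/existsP: AB => x /existsP[y /existsP[z /and3P[/apex/mem_span3]]].
have := subset_leq_card sub; rewrite cardsDS // cardsU1 tA.
by move: #|span A| #|span B|; clear; lia.
Qed.

Lemma apex_color a x : shadow A a x -> T t a x = B.
Proof. by move/apex/edgeE <-; rewrite color21 color132. Qed.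

Lemma pay_apex a S : a \in span A ->
    (forall x, x \in span A -> x != a -> shadow A a x) ->
    (forall x, x \in R -> x \in S \/ T t a x = B) ->
    (forall x, x \in S -> ~~ lower (T t a x) B) ->
  12 %/ #|S|.+1 <= pay B t a.
Proof.
move=> aA full cov noS; apply: pay_ge => //.
  by rewrite shadowC; have [x /apex/edge_shadows[]] := span_shadow aA.
move=> x xB xt xa; have [xA|xA] := boolP (x \in span A).
  by right; apply/apex_color/full.
by apply: cov; rewrite in_setD in_setU1 negb_or xt xA.
Qed.

Lemma pay_full_apex a : a \in span A ->
    (forall x, x \in span A -> x != a -> shadow A a x) ->
    (forall x, x \in R -> T t a x = B) ->
  12 <= pay B t a.
Proof.
move=> aA full cov; have := @pay_apex a set0; rewrite cards0 divn1; apply=> // x.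
  by right; exact: cov.
by rewrite inE.
Qed.

(** Here [R] is empty, so at a dominating vertex [d] of [A] the pair [t, d] sees
    only color [B], and its full charge 12 exceeds the 9 that is needed. *)
Lemma total_pay_over_span5 : #|span A| = 5 -> 18 * (7 - #|span B|) <= total_pay B.
Proof.
move=> A5; have := card_rest; rewrite A5 => B_R.
have /eqP : #|R| = 0 by lia.
rewrite cards_eq0 => /eqP R0.
have [d dA dom] := dominating_vertex A5.
apply: leq_trans (@sum_pay_apex B t [:: d] isT); rewrite big_seq1.
have : 12 <= pay B t d by apply: pay_full_apex dom _ => // x; rewrite R0 inE.
lia.
Qed.

(** There is at most one vertex [x] outside the cone.  If some [t, a, x] has
    color [B], the pair [t, a] is charged in full.  Otherwise a color [C] below
    [B] among the [t, a, x] would be the color of all of them, because [t] sees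
    the pairs of [span A] in color [B]; then [C] would cover [span B]. *)
Lemma total_pay_over_span4 : #|span A| = 4 -> 18 * (7 - #|span B|) <= total_pay B.
Proof.
move=> A4; have := card_rest; rewrite A4 => B_R.
have full a : a \in span A -> forall x, x \in span A -> x != a -> shadow A a x.
  by move=> aA x xA xa; rewrite complete_shadow ?A4 // eq_sym.
have /card_gt1P[p [q [pA qA pq]]] : 1 < #|span A| by rewrite A4.
have [R0|[x Rx]] : R = set0 \/ exists x, R = [set x].
  have [/eqP|] := posnP #|R|; first by rewrite cards_eq0 => /eqP; left.
  by move=> R_gt0; right; apply/cards1P; apply/eqP; lia.
- apply: leq_trans (@sum_pay_apex B t [:: p; q] _); last by rewrite /= inE pq.
  have full_pay a : a \in span A -> 12 <= pay B t a.
    by move=> aA; apply: pay_full_apex (full a aA) _ => // x; rewrite R0 inE.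
  by rewrite big_cons big_seq1; have := full_pay p pA; have := full_pay q qA; lia.
have B_eq6 : #|span B| = 6 by rewrite B_R Rx cards1.
rewrite B_eq6.
have [/exists_inP[a aA /eqP Ta]|] := boolP [exists a in span A, T t a x == B].
  apply: leq_trans (@sum_pay_apex B t [:: a] isT); rewrite big_seq1.
  suff : 12 <= pay B t a by lia.
  by apply: pay_full_apex (full a aA) _ => // y; rewrite Rx inE => /eqP ->.
rewrite negb_exists_in => /forall_inP noB.
have xR : x \in R by rewrite Rx inE.
have [xB xt xA] : [/\ x \in span B, x != t & x \notin span A].
  by move: xR; rewrite in_setD in_setU1 negb_or => /andP[/andP[-> ->] ->].
have ta a : a \in span A -> t != a by apply: contraTneq => <-.
have xa a : a \in span A -> x != a by apply: contraTneq => <-.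
have [/exists_inP[a aA low]|] := boolP [exists a in span A, lower (T t a x) B].
  suff sub : span B \subset span (T t a x).
    by have := proper_sub_trans (lower_proper low) sub; rewrite properxx.
  have edgeC u : u \in span A -> edge (T t a x) t u x.
    move=> uA; have [->|ua] := eqVneq u a.
      by rewrite edge_color // 1?(eq_sym _ x) // ?ta // xa.
    suff <- : T t u x = T t a x by rewrite edge_color // 1?(eq_sym _ x) // ?ta // xa.
    have Tau : T t a u = B by apply/apex_color/full.
    have uniq4 : uniq [:: t; a; x; u].
      by rewrite /= !inE !negb_or (ta a) // (ta u) // (eq_sym t) xt (eq_sym a x) (xa a) //
                 (xa u) // (eq_sym a) ua.
    have [||] := color_star uniq4; rewrite ?Tau ?noB // color132 // => TB.
    by have := noB u uA; rewrite TB eqxx.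
  apply/subsetP => u uB; have [->|ut] := eqVneq u t; first exact: mem_span (edgeC a aA).
  have [uA|uA] := boolP (u \in span A); first exact: mem_span2 (edgeC u uA).
  have : u \in R by rewrite in_setD in_setU1 negb_or ut uA.
  by rewrite Rx inE => /eqP ->; exact: mem_span3 (edgeC a aA).
rewrite negb_exists_in => /forall_inP noLow.
apply: leq_trans (@sum_pay_apex B t [:: p; q] _); last by rewrite /= inE pq.
have half_pay a : a \in span A -> 6 <= pay B t a.
  move=> aA; have := @pay_apex a [set x] aA (full a aA); rewrite cards1; apply.
    by move=> y; rewrite Rx; left.
  by move=> y; rewrite inE => /eqP ->; exact: noLow.
by rewrite big_cons big_seq1; have := half_pay p pA; have := half_pay q qA; lia.
Qed.

Hypothesis lower3 : forall C, lower C B -> #|span C| = 3.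

(** The color of [t, a, x] is here a single edge, which [b] sees in one color;
    it is the color of [t, a, b], namely [B]. *)
Lemma lower_pair_unique a b x : a \in span A -> b \in span A -> a != b ->
  x \in R -> lower (T t a x) B -> T t b x = B.
Proof.
move=> aA bA ab; rewrite in_setD in_setU1 negb_or => /andP[/andP[xt xA] _] low.
have [ta tb] : t != a /\ t != b by split; apply: contraNneq tA => ->.
have [xa xb] : x != a /\ x != b by split; apply: contraNneq xA => ->.
have e : edge (T t a x) t a x by apply: edge_color; rewrite // eq_sym.
have [sta stx _] := edge_shadows e.
have A3 := lower3 AB.
have bC : b \notin span (T t a x).
  by rewrite (span_single e (lower3 low)) !in_setU !in_set1 !negb_or (eq_sym b t) tb
             (eq_sym b a) ab (eq_sym b x) xb.
rewrite color132 (uniform bC stx sta) apex_color //.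
by rewrite complete_shadow ?A3.
Qed.

(** Each of the at most two vertices [x] outside the cone spoils at most one of
    the three pairs [t, a], and when it does, it adds to the codegree of the
    other two. *)
Lemma total_pay_over_span3 : 18 * (7 - #|span B|) <= total_pay B.
Proof.
have A3 := lower3 AB.
have := card_rest; rewrite A3 => B_R.
have full a : a \in span A -> forall x, x \in span A -> x != a -> shadow A a x.
  by move=> aA x xA xa; rewrite complete_shadow ?A3 // eq_sym.
have others a : a \in span A -> exists p q,
    [/\ p \in span A, q \in span A, a != p, a != q & p != q].
  move=> aA; have /card_gt1P[p [q [/setD1P[pa pA] /setD1P[qa qA] pq]]] :
    1 < #|span A :\ a| by have := cardsD1 a (span A); rewrite aA A3; lia.
  by exists p, q; rewrite !(eq_sym a).
have [a0 a0A] : exists a, a \in span A by apply/card_gt0P; rewrite A3.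
have sum2 p q m : p != q -> m <= pay B t p -> m <= pay B t q -> 4 * m <= total_pay B.
  move=> pq mp mq; apply: leq_trans (@sum_pay_apex B t [:: p; q] _).
    by rewrite big_cons big_seq1; move: mp mq; clear; lia.
  by rewrite /= inE pq.
have sum3 m : (forall a, a \in span A -> m <= pay B t a) -> 6 * m <= total_pay B.
  move=> ma; have [p [q [pA qA a0p a0q pq]]] := others a0 a0A.
  apply: leq_trans (@sum_pay_apex B t [:: a0; p; q] _).
    by rewrite !big_cons big_nil; move: (ma _ a0A) (ma _ pA) (ma _ qA); lia.
  by rewrite /= !inE negb_or a0p a0q pq.
have no_low a x : [forall a in span A, ~~ lower (T t a x) B] -> a \in span A ->
    ~~ lower (T t a x) B.
  by move/forall_inP; apply.
have [R0|R_gt0] := posnP #|R|.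
  have {}R0 : R = set0 by apply/eqP; rewrite -cards_eq0 R0.
  apply: leq_trans (sum3 12 _) => [|a aA]; first by rewrite B_R R0 cards0.
  by apply: pay_full_apex (full a aA) _ => // x; rewrite R0 inE.
have [R_le1|R_gt1] := leqP #|R| 1.
  have /eqP/cards1P[x Rx] : #|R| = 1 by lia.
  have xR : x \in R by rewrite Rx set11.
  have -> : 18 * (7 - #|span B|) = 36 by rewrite B_R Rx cards1.
  have [low0|] := boolP [forall a in span A, ~~ lower (T t a x) B].
    apply: leq_trans (sum3 6 _) => // a aA.
    have := @pay_apex a [set x] aA (full a aA); rewrite cards1; apply.
      by move=> y; rewrite Rx; left.
    by move=> y /set1P ->; apply: no_low.
  rewrite negb_forall_in => /exists_inP[a aA]; rewrite negbK => low.
  have [p [q [pA qA ap aq pq]]] := others a aA.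
  apply: leq_trans (sum2 p q 12 pq _ _) => //.
    apply: pay_full_apex (full p pA) _ => // y; rewrite Rx => /set1P ->.
    exact: lower_pair_unique low.
  apply: pay_full_apex (full q qA) _ => // y; rewrite Rx => /set1P ->.
  exact: lower_pair_unique low.
have /eqP/cards2P[x0 [y0 [_ Rxy0]]] : #|R| = 2 by lia.
have -> : 18 * (7 - #|span B|) = 18 by suff -> : #|span B| = 6; lia.
have caseX x y : R = [set x; y] -> ~~ [forall a in span A, ~~ lower (T t a x) B] ->
    18 <= total_pay B.
  move=> Rxy; rewrite negb_forall_in => /exists_inP[a aA]; rewrite negbK => low.
  have [xR yR] : x \in R /\ y \in R by rewrite Rxy set21 set22.
  have [p [q [pA qA ap aq pq]]] := others a aA.
  have Tx b : b \in span A -> a != b -> T t b x = B.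
    by move=> bA ab; exact: lower_pair_unique low.
  have full_y b : b \in span A -> a != b -> T t b y = B -> 18 <= total_pay B.
    move=> bA ab Ty; apply: leq_trans (@sum_pay_apex B t [:: b] isT).
    rewrite big_seq1; apply: (@leq_trans (2 * 12)); rewrite // leq_mul2l /=.
    apply: pay_full_apex (full b bA) _ => // z; rewrite Rxy => /set2P[] -> //.
    exact: Tx.
  have [lowp|lowp] := boolP (lower (T t p y) B).
    by apply: (full_y q) => //; apply: lower_pair_unique lowp.
  have [lowq|lowq] := boolP (lower (T t q y) B).
    by apply: (full_y p) => //; apply: (lower_pair_unique _ _ _ _ lowq); rewrite 1?eq_sym.
  have half b : b \in span A -> a != b -> ~~ lower (T t b y) B -> 6 <= pay B t b.
    move=> bA ab low_b; have := @pay_apex b [set y] bA (full b bA); rewrite cards1; apply.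
      by move=> z; rewrite Rxy => /set2P[] ->; [right; exact: Tx | left; exact: set11].
    by move=> z /set1P ->.
  by apply: leq_trans (sum2 p q 6 pq _ _) => //; exact: half.
have [lowx|] := boolP [forall a in span A, ~~ lower (T t a x0) B]; last exact: (caseX _ _ Rxy0).
have [lowy|] := boolP [forall a in span A, ~~ lower (T t a y0) B]; last first.
  by apply: (caseX y0 x0); rewrite Rxy0 setUC.
apply: leq_trans (sum3 4 _) => [|a aA]; first by [].
have := @pay_apex a R aA (full a aA).
have -> : #|R| = 2 by lia.
apply => [x|x]; first by left.
by rewrite Rxy0 => /set2P[] ->; apply: no_low.
Qed.

End Apex.

Lemma card_span_ge3 A x : x \in span A -> 3 <= #|span A|.
Proof.
by case/spanP => y [z e]; rewrite -(card_edge e) subset_leq_card ?edge_subset_span.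
Qed.

Lemma total_pay_ge B : 3 <= #|span B| -> 18 * (7 - #|span B|) <= total_pay B.
Proof.
move=> B3; have [B6|B7] := leqP #|span B| 6; last by have -> : 7 - #|span B| = 0 by lia.
have [noA|] := boolP [forall A, ~~ lower A B].
  apply: leq_trans (total_pay_minimal (fun A => forallP noA A) B6).
  have [B_eq4|] := eqVneq #|span B| 4; last first.
    by move: B3 B6; move: #|_| => [|[|[|[|[|[|[|m]]]]]]].
  have [A AB _] := four B_eq4.
  by have /negP := forallP noA A.
rewrite negb_forall => /existsP[A0]; rewrite negbK => A0B.
have [/existsP[A /andP[AB /eqP A5]]|no5] := boolP [exists A, lower A B && (#|span A| == 5)].
  by have [t tA apex] := lower_apex AB; exact: (total_pay_over_span5 AB tA apex B6 A5).
have [/existsP[A /andP[AB /eqP A4]]|no4] := boolP [exists A, lower A B && (#|span A| == 4)].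
  by have [t tA apex] := lower_apex AB; exact: (total_pay_over_span4 AB tA apex B6 A4).
have [t tA0 apex] := lower_apex A0B.
apply: (total_pay_over_span3 A0B tA0 apex B6) => C CB.
have C5 : #|span C| != 5.
  by apply: contra no5 => C5; apply/existsP; exists C; rewrite CB.
have C4 : #|span C| != 4.
  by apply: contra no4 => C4; apply/existsP; exists C; rewrite CB.
have C3 : 3 <= #|span C|.
  by case/existsP: CB => x /existsP[y /existsP[z /and3P[/shadow_span/card_span_ge3]]].
have := proper_card (lower_proper CB); lia.
Qed.

Definition used : {set K} := [set A | span A != set0].

(** The total charge is 12 for each ordered pair. *)
Lemma sum_small_span :
  \sum_(A in used) 3 * (7 - #|span A|) <= 2 * (#|V| * #|V|.-1).
Proof.
rewrite -(leq_pmul2l (isT : 0 < 6)) big_distrr /= [leqRHS]mulnA.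
apply: leq_trans sum_pay_all; rewrite [leqRHS](bigID (mem used)) /=.
apply: leq_trans (leq_addr _ _); apply: leq_sum => A; rewrite inE => /set0Pn[x /card_span_ge3 A3].
by rewrite mulnA; exact: total_pay_ge.
Qed.

(** * Counting the colors at a vertex *)

Section Gallai.

Variable x : V.

Let star_colors S : {set K} := [set A | [exists y in S, exists z in S, edge A x y z]].

Lemma star_colorsP A S :
  reflect (exists y z, [/\ y \in S, z \in S & edge A x y z]) (A \in star_colors S).
Proof.
rewrite inE; apply: (iffP exists_inP) => [[y yS /exists_inP[z zS e]]|[y [z [yS zS e]]]].
  by exists y, z.
by exists y => //; apply/exists_inP; exists z.
Qed.

(** Deleting a vertex [v] from [S] loses at most one color: if [A] and [B] were
    both lost, with edges [xva] and [xvb], then [xab] would have color [A] or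
    [B] by [color_star]. *)
Lemma card_star_colors S : #|star_colors S| <= #|S|.-1.
Proof.
have [m] := ubnP #|S|; elim: m S => // m IH S; rewrite ltnS => leSm.
have [S_le1|S_gt1] := leqP #|S| 1.
  suff -> : star_colors S = set0 by rewrite cards0.
  apply/setP => A; rewrite in_set0; apply/negP => /star_colorsP[y [z [yS zS e]]].
  have [_ _] := edge_neq e; have /card_le1_eqP/(_ y z yS zS) -> := S_le1.
  by rewrite eqxx.
have /card_gt0P[v vS] : 0 < #|S| by exact: ltnW.
have cS : #|S| = #|S :\ v|.+1 by rewrite (cardsD1 v S) vS.
have new A : A \in star_colors S :\: star_colors (S :\ v) ->
    exists2 a, a \in S :\ v & edge A x v a.
  case/setDP => /star_colorsP[y [z [yS zS e]]] old.
  have [_ _ yz] := edge_neq e.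
  have [yv|yv] := eqVneq y v.
    by exists z; rewrite -?yv // in_setD1 zS eq_sym yz.
  have [zv|zv] := eqVneq z v.
    by exists y; rewrite ?in_setD1 ?yv // edge132 -zv.
  by case/star_colorsP: old; exists y, z; rewrite !in_setD1 yv zv.
have le1 : #|star_colors S :\: star_colors (S :\ v)| <= 1.
  apply/card_le1_eqP => A B newA newB; case: (eqVneq A B) => // AB; exfalso.
  have [a aS eA] := new A newA; have [b bS eB] := new B newB.
  have [xv xa va] := edge_neq eA; have [_ xb vb] := edge_neq eB.
  have ab : a != b by apply: contra_neq AB => ab; rewrite -(edgeE eA) ab (edgeE eB).
  have uniq4 : uniq [:: x; v; a; b] by rewrite /= !inE !negb_or xv xa xb va vb ab.
  have e := edge_color xa xb ab.
  have /setDP[_ /negP oldA] := newA; have /setDP[_ /negP oldB] := newB.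
  have ne : T x v a != T x v b by rewrite (edgeE eA) (edgeE eB).
  have [] := color_star uniq4 ne; rewrite ?(edgeE eA) ?(edgeE eB) => Tab.
    by apply: oldA; apply/star_colorsP; exists a, b; rewrite -Tab.
  by apply: oldB; apply/star_colorsP; exists a, b; rewrite -Tab.
rewrite -(cardsID (star_colors (S :\ v))) cS /=.
have leI : #|star_colors S :&: star_colors (S :\ v)| <= #|S :\ v|.-1.
  apply: leq_trans (subset_leq_card (subsetIr _ _)) (IH _ _); lia.
lia.
Qed.

End Gallai.

Lemma colors_at_vertex x : #|[set A | x \in span A]| <= #|V| - 2.
Proof.
have -> : #|V| - 2 = #|[set~ x]|.-1 by rewrite cardsC1; lia.
apply: leq_trans (card_star_colors x _); apply/subset_leq_card/subsetP => A.
rewrite inE => /spanP[y [z e]]; have [xy xz _] := edge_neq e.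
by apply/star_colorsP; exists y, z; rewrite !in_setC1 !(eq_sym _ x).
Qed.

Lemma card_used_le : 21 * #|used| <= 3 * (#|V| * (#|V| - 2)) + 2 * (#|V| * #|V|.-1).
Proof.
have sum_span : \sum_(A in used) #|span A| <= #|V| * (#|V| - 2).
  apply: leq_trans (_ : \sum_A #|span A| <= _).
    by rewrite [leqRHS](bigID (mem used)) leq_addr.
  under eq_bigr do rewrite -sum1_card big_mkcond.
  rewrite exchange_big -sum_nat_const /=; apply: leq_sum => x _.
  by rewrite -big_mkcond sum1_card -cardsE colors_at_vertex.
rewrite mulnC -sum_nat_const.
apply: leq_trans (_ : \sum_(A in used) (3 * #|span A| + 3 * (7 - #|span A|)) <= _).
  by apply: leq_sum => A _; lia.
rewrite big_split /= leq_add ?sum_small_span // -big_distrr /=.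
by rewrite leq_mul2l sum_span.
Qed.

End Coloring.

(** * Optimal colorings *)

Section Extremal.

Variables (V K : finType).
Implicit Types (c : {ffun {set V} -> K}) (A B D E : K) (x y z t w : V) (e f g h : {set V}).

Definition F4_freeb c :=
  [forall x, forall y, forall z, forall t, uniq [:: x; y; z; t] ==>
    ~~ uniq [:: c [set x; y; z]; c [set x; y; t]; c [set y; z; t]]].

Lemma F4_freeP c : reflect (F4_free c) (F4_freeb c).
Proof.
apply: (iffP forallP) => [h x y z t u|h x].
  by move/forallP/(_ y)/forallP/(_ z)/forallP/(_ t)/implyP/(_ u): (h x).
by apply/forallP => y; apply/forallP => z; apply/forallP => t; apply/implyP; exact: h.
Qed.

Definition singles c : {set K} := [set A | #|span c A| == 3].

(** The number of single-edge colors breaks ties so that a color on four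
    vertices always has a single edge below it ([optimal_span4]). *)
Definition optimal c := [/\ F4_free c,
  forall c', F4_free c' -> #|used c'| <= #|used c| &
  forall c', F4_free c' -> #|used c'| = #|used c| -> #|singles c'| <= #|singles c|].

Lemma exists_optimal c0 : F4_free c0 ->
  exists2 c, optimal c & #|used c0| <= #|used c|.
Proof.
move=> /F4_freeP free0; pose score c := #|used c| * #|K|.+1 + #|singles c|.
have [c /F4_freeP freec maxc] := @arg_maxnP _ c0 F4_freeb score free0.
have lt_singles c' : #|singles c'| < #|K|.+1 by rewrite ltnS max_card.
have max1 c' : F4_free c' -> #|used c'| <= #|used c|.
  move=> /F4_freeP/maxc; rewrite leqNgt; apply: contraL => lt_used.
  rewrite -ltnNge; apply: (@leq_trans (#|used c|.+1 * #|K|.+1)).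
    by rewrite mulSn addnC /score ltn_add2l.
  by apply: leq_trans (leq_addr _ _); rewrite leq_mul2r lt_used orbT.
exists c; last by apply: max1; exact/F4_freeP.
by split=> // c' /F4_freeP/maxc; rewrite /score /= => + eq_used; rewrite eq_used leq_add2l.
Qed.

Lemma set3_of_pair e x y : #|e| = 3 -> x \in e -> y \in e -> x != y ->
  exists2 z, e = [set x; y; z] & x != z /\ y != z.
Proof.
move=> e3 xe ye xy.
have /card_gt0P[z] : 0 < #|e :\: [set x; y]|.
  by rewrite cardsDS ?subUset ?sub1set ?xe // cards2 xy e3.
rewrite !inE negb_or => /andP[/andP[zx zy] ze]; exists z; last by rewrite !(eq_sym _ z).
apply/esym/eqP; rewrite eqEcard !subUset !sub1set xe ye ze e3 setUC cardsU1 cards2.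
by rewrite !inE negb_or zx zy xy.
Qed.

Lemma card_set3I x y z t : x != y -> z != t ->
  #|[set x; y; z] :&: [set x; y; t]| = 2.
Proof.
move=> xy zt; rewrite -setUIr (_ : [set z] :&: [set t] = set0) ?setU0 ?cards2 ?xy //.
by apply/setP => u; rewrite !inE; apply/andP => -[/eqP -> /eqP ztE]; rewrite ztE eqxx in zt.
Qed.

Lemma set3_rot x y z : [set x; y; z] = [set y; z; x].
Proof. by rewrite -setUA setUC. Qed.

Lemma set3P e : #|e| = 3 -> exists x y z, e = [set x; y; z] /\ [/\ x != y, x != z & y != z].
Proof.
move=> e3; have /card_gt1P[x [y [xe ye xy]]] : 1 < #|e| by rewrite e3.
by have [z -> []] := set3_of_pair e3 xe ye xy; exists x, y, z.
Qed.

Lemma usedP c A : reflect (exists2 e : {set V}, #|e| = 3 & c e = A) (A \in used c).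
Proof.
rewrite inE; apply: (iffP (set0Pn _)) => [[x /spanP[y [z e]]]|[e e3 <-]].
  by exists [set x; y; z]; [exact: (card_edge e) | exact: (edgeE e)].
have [x [y [z [-> [xy xz yz]]]]] := set3P e3.
by exists x; apply: (@mem_span _ _ _ _ _ y z); exact: edge_color.
Qed.

Lemma fresh_color c : 'C(#|V|, 3) < #|K| -> exists A, A \notin used c.
Proof.
move=> ltK; have /card_gt0P[A] : 0 < #|~: used c|.
  rewrite cardsCs setCK subn_gt0; apply: leq_ltn_trans ltK.
  rewrite -card_draws; apply: leq_trans (leq_imset_card c _).
  apply/subset_leq_card/subsetP => A /usedP[e e3 <-]; apply: imset_f.
  by rewrite inE e3.
by rewrite inE; exists A.
Qed.

Lemma set3_share2 e f : #|e| = 3 -> #|f| = 3 -> #|e :&: f| = 2 ->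
  exists x y z t, [/\ e = [set x; y; z], f = [set x; y; t] &
    [/\ x != y, x != z, y != z, x != t & y != t]].
Proof.
move=> e3 f3 ef2.
have /card_gt1P[x [y [/setIP[xe xf] /setIP[ye yf] xy]]] : 1 < #|e :&: f| by rewrite ef2.
have [z -> [xz yz]] := set3_of_pair e3 xe ye xy.
by have [t -> [xt yt]] := set3_of_pair f3 xf yf xy; exists x, y, z, t.
Qed.

Section Optimal.

Variable c : {ffun {set V} -> K}.
Hypotheses (ltK : 'C(#|V|, 3) < #|K|) (optc : optimal c).

Let free : F4_free c. Proof. by case: optc. Qed.

Definition edges A : {set {set V}} := [set e : {set V} | (#|e| == 3) && (c e == A)].

Lemma edgesP A x y z : edge c A x y z -> [set x; y; z] \in edges A.
Proof. by move=> e; rewrite inE (card_edge e) (edgeE e) !eqxx. Qed.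

Lemma edge_of A x y z : [set x; y; z] \in edges A -> x != y -> x != z -> y != z ->
  edge c A x y z.
Proof. by rewrite inE => /andP[_ cA] xy xz yz; apply/and4P. Qed.

(** If no edge in [X] shared a pair with an edge of [A] outside [X], giving a
    new color to [X] would keep the coloring free of rainbow copies, because
    any two triples on four vertices share a pair. *)
Lemma tightly_connected A (X : {set {set V}}) : X \proper edges A -> X != set0 ->
  exists2 e, e \in X & exists2 f, f \in edges A :\: X & #|e :&: f| = 2.
Proof.
move=> XA /set0Pn[e0 e0X]; have XsubA := proper_sub XA.
pose joined := [exists e in X, exists f in edges A :\: X, #|e :&: f| == 2].
have [/exists_inP[e eX /exists_inP[f fX /eqP ef]]|sep] := boolP joined.
  by exists e => //; exists f.
have [F noF] := fresh_color c ltK.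
pose c' : {ffun {set V} -> K} := [ffun e => if e \in X then F else c e].
have cX e : e \in X -> #|e| = 3 /\ c e = A.
  by move/(subsetP XsubA); rewrite inE => /andP[/eqP ? /eqP].
have same e f : #|e| = 3 -> #|f| = 3 -> #|e :&: f| = 2 -> c e = c f -> c' e = c' f.
  have half g h : #|h| = 3 -> #|g :&: h| = 2 -> g \in X -> c g = c h -> h \in X.
    move=> h3 gh gX; have [g3 ->] := cX g gX => hA; apply: contraNT sep => hX.
    apply/exists_inP; exists g => //; apply/exists_inP; exists h; last exact/eqP.
    by rewrite in_setD hX inE h3 -hA !eqxx.
  move=> e3 f3 ef cef; rewrite !ffunE.
  case: (boolP (e \in X)) => eX; first by rewrite (half e f).
  by case: (boolP (f \in X)) => // fX; rewrite (half f e) // 1?setIC // in eX.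
have free' : F4_free c'.
  move=> x y z t u; apply: contra (free u).
  have [[xy xz xt] yz yt zt] := uniq4P _ _ _ _ u.
  rewrite /= !inE !negb_or !andbT -!andbA => /and3P[ne1 ne2 ne3]; apply/and3P; split.
  - apply: contra ne1 => /eqP eqc; apply/eqP/same => //; rewrite ?card_set3 //.
    exact: (card_set3I xy zt).
  - apply: contra ne2 => /eqP eqc; apply/eqP/same => //; rewrite ?card_set3 //.
    by rewrite set3_rot card_set3I // eq_sym.
  apply: contra ne3 => /eqP eqc; apply/eqP/same => //; rewrite ?card_set3 //.
  by rewrite set3_rot (setUAC [set y] [set z]) card_set3I.
have used' : F |: used c \subset used c'.
  rewrite subUset sub1set; apply/andP; split.
    by apply/usedP; exists e0; [case: (cX e0) | rewrite ffunE e0X].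
  apply/subsetP => B /usedP[e e3 <-]; apply/usedP.
  have [eX|eX] := boolP (e \in X); last by exists e; rewrite // ffunE (negPf eX).
  case/properP: XA => _ [f]; rewrite inE => /andP[/eqP f3 /eqP fA] fX.
  by exists f; rewrite // ffunE (negPf fX) fA; case: (cX e).
case: optc => _ /(_ c' free') max1 _.
by have := subset_leq_card used'; rewrite cardsU1 noF ltnNge max1.
Qed.

Local Notation T x y z := (c [set x; y; z]).

(** Four vertices see at most two colors, and [A] is not among those of the
    triples through [w]. *)
Lemma uniform_edge A x y z w : edge c A x y z -> w \notin span c A ->
  T x y w = T x z w /\ T x y w = T y z w.
Proof.
move=> e wA; have [xy xz yz] := edge_neq e.
have ne u : u \in span c A -> u != w by apply: contraTneq => ->.
have [xw yw zw] : [/\ x != w, y != w & z != w].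
  by rewrite !ne ?(mem_span e) ?(mem_span2 e) ?(mem_span3 e).
have not_A u v : u != v -> u != w -> v != w -> T u v w != A.
  move=> uv uw vw; apply: contra wA => /eqP TA.
  by rewrite -TA; exact: (mem_span3 (edge_color c uv uw vw)).
have ne_w : T x y z != T x y w by rewrite (edgeE e) eq_sym not_A.
split.
  have [] := color_star free (introT (uniq4P x y z w) (And4 (And3 xy xz xw) yz yw zw)) ne_w => //.
  by rewrite (edgeE e) => /eqP; rewrite (negPf (not_A _ _ xz xw zw)).
have [] := color_star free (introT (uniq4P y x z w) _); rewrite ?(color21 _ y x) // 1?eq_sym //.
  by rewrite (edgeE e) => /eqP; rewrite (negPf (not_A _ _ yz yw zw)).
Qed.

(** The edges of [A] all of whose pairs [w] sees in a given color are closed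
    under sharing a pair, so tight connectivity makes them all of [A]. *)
Lemma uniform_shadow A w x y x' y' : w \notin span c A ->
  shadow c A x y -> shadow c A x' y' -> T x y w = T x' y' w.
Proof.
move=> wA /shadowP[z e] /shadowP[z' e'].
pose all_D e := [forall p in e, forall q in e, (p != q) ==> (T p q w == T x y w)].
pose X := [set f in edges A | all_D f].
have all_DP u v r : edge c A u v r -> (T u v w == T x y w) = all_D [set u; v; r].
  move=> euv; have [E1 E2] := uniform_edge euv wA.
  apply/idP/forall_inP => [/eqP TD p pS|all_uvr]; last first.
    have [uv _ _] := edge_neq euv.
    have [uS vS] : u \in [set u; v; r] /\ v \in [set u; v; r] by rewrite !inE !eqxx ?orbT.
    by have /forall_inP all_v := all_uvr u uS; have := all_v v vS; rewrite uv.
  apply/forall_inP => q qS; apply/implyP => pq; rewrite -TD.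
  by move: pS qS pq => /setUP[/set2P[]|/set1P] -> /setUP[/set2P[]|/set1P] ->;
    rewrite ?eqxx // => _; rewrite ?(color21 _ v u) ?(color21 _ r) -?E1 -?E2.
suff /(subsetP)/(_ _ (edgesP e')) : edges A \subset X.
  by rewrite inE -all_DP // => /andP[_ /eqP].
apply: contraT => nsub.
have XA : X \proper edges A.
  by rewrite properE nsub andbT; apply/subsetP => f; rewrite inE => /andP[].
have X0 : X != set0.
  by apply/set0Pn; exists [set x; y; z]; rewrite inE edgesP // -all_DP // eqxx.
have [f fX [g gX fg]] := tightly_connected XA X0.
have [fA f_all] : f \in edges A /\ all_D f by apply/andP; rewrite inE in fX.
have [gA gNX] := setDP gX.
have [f3 g3] : #|f| = 3 /\ #|g| = 3.
  by move: fA gA; rewrite !inE => /andP[/eqP-> _] /andP[/eqP-> _].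
have [p [q [r [s [fE gE [pq pr qr ps qs]]]]]] := set3_share2 f3 g3 fg.
rewrite fE in fA f_all; rewrite gE in gA gNX.
case/negP: gNX; rewrite inE gA -all_DP ?(all_DP _ _ r) //; exact: edge_of.
Qed.

Lemma shadow_grow A (S : {set V}) :
  (exists x y z, edge c A x y z /\ [set x; y; z] \subset S) ->
  ~~ (span c A \subset S) ->
  exists x y z w, [/\ edge c A x y z, [set x; y; z] \subset S,
                      edge c A x y w & w \notin S].
Proof.
move=> [x [y [z [e sub]]]] nsub; pose X := [set f in edges A | f \subset S].
have X0 : X != set0 by apply/set0Pn; exists [set x; y; z]; rewrite inE edgesP.
have XA : X \proper edges A.
  apply/properP; split; first by apply/subsetP => f; rewrite inE => /andP[].
  have [v /spanP[u [r e']] vS] := subsetPn nsub.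
  exists [set v; u; r]; first exact: edgesP.
  rewrite in_set edgesP //=.
  by apply: contra vS => /subsetP; apply; rewrite !inE eqxx.
have [f fX [g gX fg]] := tightly_connected XA X0.
have [fA fS] : f \in edges A /\ f \subset S by apply/andP; rewrite inE in fX.
have [gA gNX] := setDP gX.
have [f3 g3] : #|f| = 3 /\ #|g| = 3.
  by move: fA gA; rewrite !inE => /andP[/eqP-> _] /andP[/eqP-> _].
have [p [q [r [s [fE gE [pq pr qr ps qs]]]]]] := set3_share2 f3 g3 fg.
rewrite fE in fA fS; rewrite gE in gA gNX.
exists p, q, r, s; split=> //; [exact: edge_of|exact: edge_of|].
apply: contra gNX => sS; rewrite inE gA !subUset !sub1set sS andbT.
by move: fS; rewrite !subUset !sub1set => /andP[].
Qed.

(** Four vertices not all covered by [A] contain at most one edge of color [A],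
    and by [uniform_edge] the other three triples then have equal colors.  So
    the edges of [A] may be recolored with regard only to the four-sets inside
    [span A]. *)
Lemma recolor_free A (c' : {ffun {set V} -> K}) :
    (forall e, #|e| = 3 -> e \notin edges A -> c' e = c e) ->
    (exists E F, forall e, #|e| = 3 -> e \subset span c A -> c' e = E \/ c' e = F) ->
  F4_free c'.
Proof.
move=> same [E [F EF]] x y z t u; have [[xy xz xt] yz yt zt] := uniq4P _ _ _ _ u.
have outside w a b : w \notin span c A -> a != b -> a != w -> b != w ->
    c' [set a; b; w] = T a b w.
  move=> wA ab aw bw; apply: same; first by rewrite card_set3.
  by apply: contra wA => ew; apply: (mem_span3 (edge_of ew ab aw bw)).
have opposite p q r w : p != q -> p != r -> q != r -> p != w -> q != w -> r != w ->
    w \notin span c A -> c' [set p; q; r] = T p q r \/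
    c' [set p; q; w] = c' [set p; r; w] /\ c' [set p; q; w] = c' [set q; r; w].
  move=> pq pr qr pw qw rw wA.
  have [eA|eA] := boolP ([set p; q; r] \in edges A); last by left; rewrite same ?card_set3.
  have [E1 E2] := uniform_edge (edge_of eA pq pr qr) wA.
  by right; rewrite !outside // -E1 -E2.
have [inA|] := boolP ([set x; y; z] :|: [set t] \subset span c A).
  have in2 p q r : [set p; q; r] \subset [set x; y; z] :|: [set t] ->
      p != q -> p != r -> q != r -> c' [set p; q; r] = E \/ c' [set p; q; r] = F.
    by move=> sub pq pr qr; apply: EF (subset_trans sub inA); rewrite card_set3.
  have in3 p q r : p \in [set x; y; z] :|: [set t] -> q \in [set x; y; z] :|: [set t] ->
      r \in [set x; y; z] :|: [set t] -> [set p; q; r] \subset [set x; y; z] :|: [set t].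
    by move=> pS qS rS; rewrite !subUset !sub1set pS qS rS.
  have Qxyz : c' [set x; y; z] = E \/ c' [set x; y; z] = F.
    by apply: in2 => //; apply: in3; rewrite !inE eqxx ?orbT.
  have Qxyt : c' [set x; y; t] = E \/ c' [set x; y; t] = F.
    by apply: in2 => //; apply: in3; rewrite !inE eqxx ?orbT.
  have Qyzt : c' [set y; z; t] = E \/ c' [set y; z; t] = F.
    by apply: in2 => //; apply: in3; rewrite !inE eqxx ?orbT.
  by case: Qxyz => ->; case: Qxyt => ->; case: Qyzt => ->; rewrite /= !inE eqxx ?orbT ?andbF.
have [yx zx tx] : [/\ y != x, z != x & t != x] by rewrite !(eq_sym _ x).
have [zy ty tz] : [/\ z != y, t != y & t != z] by rewrite !(eq_sym _ y) (eq_sym t z).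
have [xA|xA _] := boolP (x \in span c A); last first.
  move: (free u); rewrite (set3_rot x y z) (set3_rot x y t).
  have [E1|[-> _]] := opposite y z t x yz yt zt yx zx tx xA; last by rewrite /= !inE eqxx.
  by rewrite E1 !(outside x).
have [yA|yA _] := boolP (y \in span c A); last first.
  move: (free u); rewrite (setUAC [set x] [set y] [set z]) (setUAC [set x] [set y] [set t]).
  by rewrite (set3_rot y z t) !(outside y).
have [zA|zA _] := boolP (z \in span c A); last first.
  move: (free u); rewrite (setUAC [set y] [set z] [set t]).
  have [E1|[_ ->]] := opposite x y t z xy xt yt xz yz tz zA; last first.
    by rewrite /= !inE eqxx orbT.
  by rewrite E1 !(outside z).
rewrite !subUset !sub1set xA yA zA /= => tA; move: (free u).
have [E1|[_ ->]] := opposite x y z t xy xz yz xt yt zt tA; last first.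
  by rewrite /= !inE eqxx andbF.
by rewrite E1 !(outside t).
Qed.

(** Let [E] be the other color inside the four-set [span A]; if there is none,
    one edge of [A] could receive a new color.  If [E] is a single edge, it is
    lower than [A].  Otherwise moving all edges of [A] but one to [E] would
    create a further single-edge color. *)
Lemma optimal_span4 A : #|span c A| = 4 -> exists2 D, lower c D A & #|span c D| = 3.
Proof.
move=> A4; have /card_gt0P[x0 /spanP[y0 [z0 eA]]] : 0 < #|span c A| by rewrite A4.
pose e0 := [set x0; y0; z0]; have e03 : #|e0| = 3 := card_edge eA.
have e0A : e0 \in edges A := edgesP eA.
have [_ max_used max_singles] := optc.
have [/forallP allA|] := boolP [forall e : {set V},
    (#|e| == 3) && (e \subset span c A) ==> (c e == A)].
  have [F noF] := fresh_color c ltK.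
  pose c' : {ffun {set V} -> K} := [ffun e => if e == e0 then F else c e].
  have [t tA te0] : exists2 t, t \in span c A & t \notin e0.
    by apply/subsetPn/negP => /subset_leq_card; rewrite A4 e03.
  have free' : F4_free c'.
    apply: (@recolor_free A) => [e _ eA'|].
      by rewrite ffunE; case: eqP eA' => // ->; rewrite e0A.
    exists F, A => e e3 eS; rewrite ffunE; case: eqP => _; first by left.
    by right; apply/eqP; have := allA e; rewrite e3 eS.
  suff : F |: used c \subset used c'.
    by move/subset_leq_card; rewrite cardsU1 noF ltnNge max_used.
  rewrite subUset sub1set; apply/andP; split.
    by apply/usedP; exists e0; rewrite // ffunE eqxx.
  apply/subsetP => B /usedP[e e3 <-]; apply/usedP.
  have [->|e_e0] := eqVneq e e0; last by exists e; rewrite // ffunE (negPf e_e0).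
  have [x0y0 _ _] := edge_neq eA.
  have [x0t y0t] : x0 != t /\ y0 != t.
    by split; apply: contraNneq te0 => <-; rewrite !inE eqxx ?orbT.
  exists [set x0; y0; t]; first by rewrite card_set3.
  rewrite ffunE; case: eqP => [E|_].
    by case/negP: te0; rewrite -E !inE eqxx orbT.
  have /eqP -> : T x0 y0 t == A; last by rewrite (edgeE eA).
  have := allA [set x0; y0; t]; rewrite card_set3 //= !subUset !sub1set tA.
  by rewrite (mem_span eA) (mem_span2 eA).
rewrite negb_forall => /existsP[f]; rewrite negb_imply => /andP[/andP[/eqP f3 fS] fA].
have fe0 : f != e0 by apply: contraNneq fA => ->; rewrite (edgeE eA).
have ef2 : #|e0 :&: f| = 2.
  have : #|e0 :|: f| <= 4 by rewrite -A4 subset_leq_card // subUset edge_subset_span.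
  have : #|e0 :&: f| < 3.
    rewrite -e03; apply: proper_card; rewrite properEneq subsetIl andbT.
    apply: contra fe0 => /eqP/setIidPl e0f; rewrite eq_sym.
    by rewrite eqEcard e0f f3 e03.
  have := cardsU e0 f; have := subset_leq_card (subsetIl e0 f); lia.
have [x [y [z [t [e0E fE [xy xz yz xt yt]]]]]] := set3_share2 e03 f3 ef2.
rewrite e0E in e0A fe0 e03 *; rewrite fE in fA fe0 f3 fS.
have {}eA : edge c A x y z by exact: edge_of.
have zt : z != t by apply: contraNneq fe0 => ->.
have defA : span c A = t |: [set x; y; z].
  apply/esym/eqP; rewrite eqEcard A4 cardsU1 e03 !inE !negb_or !(eq_sym t) xt yt zt andbT.
  by rewrite subUset edge_subset_span // sub1set (subsetP fS) // !inE eqxx orbT.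
pose E := T x y t.
have colors e : #|e| = 3 -> e \subset span c A -> c e = A \/ c e = E.
  move=> e3 eS.
  have missing p q r u : p != q -> p != r -> q != r -> u \notin e ->
      {subset span c A <= u |: [set p; q; r]} -> e = [set p; q; r].
    move=> pq pr qr ue sub; apply/eqP; rewrite eqEcard e3 card_set3 // andbT.
    apply/subsetP => v ve; have := sub v (subsetP eS v ve).
    by case/setU1P => // vu; rewrite -vu ve in ue.
  have /subsetPn[u uA ue] : ~~ (span c A \subset e).
    by apply/negP => /subset_leq_card; rewrite A4 e3.
  have ne : T x y z != T x y t by rewrite (edgeE eA) eq_sym.
  have TA : T x y z = A := edgeE eA.
  move: uA; rewrite defA => /setU1P[|/setUP[/set2P[]|/set1P]] Eu; rewrite Eu in ue.
  - by left; rewrite -TA (missing x y z t) // defA.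
  - rewrite (missing y z t x) //; last first.
      by move=> v; rewrite defA !inE -!orbA => /or4P[] ->; rewrite ?orbT.
    have u4 : uniq [:: y; x; z; t] by apply/uniq4P; rewrite (eq_sym y x).
    by have := color_star free u4; rewrite !(color21 _ y x) => /(_ ne); rewrite TA.
  - rewrite (missing x z t y) //; last first.
      by move=> v; rewrite defA !inE -!orbA => /or4P[] ->; rewrite ?orbT.
    have u4 : uniq [:: x; y; z; t] by apply/uniq4P.
    by have := color_star free u4 ne; rewrite TA.
  right; rewrite (missing x y t z) // => v.
  by rewrite defA !inE -!orbA => /or4P[] ->; rewrite ?orbT.
have [E3|E3] := eqVneq #|span c E| 3.
  exists E => //; have eE : edge c E x y t by exact: edge_color.
  apply/existsP; exists x; apply/existsP; exists y; apply/existsP; exists z.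
  rewrite (edge_shadow eE) eA andbT (span_single eE E3).
  by rewrite !inE !negb_or !(eq_sym z) xz yz eq_sym zt.
pose c' : {ffun {set V} -> K} :=
  [ffun e => if (e \in edges A) && (e != [set x; y; z]) then E else c e].
have c'x : c' [set x; y; z] = A by rewrite ffunE eqxx andbF (edgeE eA).
have cA e : e \in edges A -> c e = A by rewrite inE => /andP[_ /eqP].
have other D e : D != A -> D != E -> (c' e == D) = (c e == D).
  move=> DA DE; rewrite ffunE; case: ifP => // /andP[/cA -> _].
  by rewrite !(eq_sym _ D) (negPf DA) (negPf DE).
have free' : F4_free c'.
  apply: (@recolor_free A) => [e _ eA'|]; first by rewrite ffunE (negPf eA').
  exists E, A => e e3 /(colors e e3) cAE; rewrite ffunE.
  by case: ifP => _; [left | case: cAE; [right | left]].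
have used' : used c \subset used c'.
  apply/subsetP => B /usedP[e e3 <-]; apply/usedP.
  have [eA'|eA'] := boolP (e \in edges A); last by exists e; rewrite // ffunE (negPf eA').
  by exists [set x; y; z]; rewrite // c'x cA.
have eq_used : #|used c'| = #|used c|.
  by apply/eqP; rewrite eqn_leq max_used // subset_leq_card.
have := max_singles c' free' eq_used; rewrite leqNgt => /negP[].
suff : A |: singles c \subset singles c'.
  by move/subset_leq_card; rewrite cardsU1 inE A4.
have span'A : span c' A = [set x; y; z].
  apply/eqP; rewrite eqEsubset edge_subset_span ?andbT; last first.
    by apply/and4P; split=> //; rewrite c'x.
  apply/subsetP => v /spanP[p [q]] /and4P[vp vq pq].
  rewrite ffunE; case: ifP => [_|+ cvpq].
    by rewrite /E (negPf fA).
  by rewrite inE card_set3 // cvpq /= => /negbFE/eqP <-; rewrite !inE eqxx.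
apply/subsetP => D /setU1P[->|]; first by rewrite inE span'A e03.
rewrite !in_set => D3.
have DA : D != A by apply: contraTneq D3 => ->; rewrite A4.
have DE : D != E by apply: contraTneq D3 => ->.
suff -> : span c' D = span c D by [].
apply/setP => v; apply/spanP/spanP => -[p [q /and4P[vp vq pq]]]; rewrite ?other // => cD;
  by exists p, q; apply/and4P; split; rewrite ?other.
Qed.

End Optimal.

Lemma card_used_free c : 'C(#|V|, 3) < #|K| -> F4_free c ->
  21 * #|used c| <= 3 * (#|V| * (#|V| - 2)) + 2 * (#|V| * #|V|.-1).
Proof.
move=> ltK /exists_optimal[d optd le_cd].
apply: leq_trans (_ : 21 * #|used d| <= _); first by rewrite leq_mul2l.
apply: card_used_le; first by case: optd.
- exact: uniform_shadow.
- exact: shadow_grow.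
exact: optimal_span4.
Qed.

End Extremal.

Lemma ar_F4_upper n : 3 <= n ->
  21 * ar_F4 n <= 3 * (n * (n - 2)) + 2 * (n * n.-1).
Proof.
move=> n3; have /existsP[c0 /andP[/eqP surj norb]] := ar_F4_attained n3.
pose N := 'C(n, 3).+1.
have lek : ar_F4 n <= 'C(n, 3).
  by rewrite -[leqLHS]card_ord -cardsT -surj -card_triples leq_imset_card.
pose c : {ffun {set 'I_n} -> 'I_N} := [ffun e => widen_ord (leqW lek) (c0 e)].
have inj : injective (widen_ord (leqW lek)) by move=> i j /(congr1 val)/= /val_inj.
have free : F4_free c.
  move=> x y z t u; apply: contra norb => uc.
  apply/existsP; exists x; apply/existsP; exists y; apply/existsP; exists z.
  apply/existsP; exists t; rewrite /rainbow_F4 u andTb -(map_inj_uniq inj) /=.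
  by move: uc; rewrite /= !ffunE.
have := card_used_free _ free; rewrite !card_ord => /(_ (ltnSn _)).
apply: leq_trans; rewrite leq_mul2l /=.
rewrite -[leqLHS]card_ord -cardsT -surj -(card_imset _ inj).
apply/subset_leq_card/subsetP => _ /imsetP[_ /imsetP[e eT ->] ->].
by apply/usedP; exists e; [rewrite inE in eT; apply/eqP | rewrite ffunE].
Qed.

(** * Lower bounds from partial Steiner triple systems *)

Lemma ar_F4_ge n (K : finType) (c : {set 'I_n} -> K) : 3 <= n -> F4_free c ->
  #|c @: triples n| <= ar_F4 n.
Proof.
move=> n3 free; apply: ar_F4_max.
have /card_gt0P[e0 e0T] : 0 < #|triples n| by rewrite card_triples bin_gt0.
have h := imset_f c e0T; pose g := enum_rank_in h.
apply/existsP; exists [ffun e => g (c e)]; apply/andP; split.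
  apply/eqP/setP => i; rewrite in_setT; apply/imsetP.
  have /imsetP[e eT Ei] := enum_valP i; exists e => //.
  by rewrite ffunE /g -Ei enum_valK_in.
apply/existsP => -[x /existsP[y /existsP[z /existsP[t /andP[u]]]]].
rewrite !ffunE; apply/negP; apply: contra (free x y z t u) => gu.
exact: (@map_uniq _ _ g [:: c _; c _; c _]).
Qed.

Lemma mem_triples n (x y z : 'I_n) : x != y -> x != z -> y != z ->
  [set x; y; z] \in triples n.
Proof. by move=> xy xz yz; rewrite inE card_set3. Qed.

Lemma partial_STS_eq n (S : {set {set 'I_n}}) e f x y : partial_STS S ->
  e \in S -> f \in S -> x != y -> x \in e -> y \in e -> x \in f -> y \in f -> e = f.
Proof.
move=> /andP[_ /forallP/(_ x)/forallP/(_ y)/implyP one] eS fS xy xe ye xf yf.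
by have /card_le1_eqP := one xy; apply; rewrite inE ?eS ?fS ?xe ?ye ?xf ?yf.
Qed.

Lemma max_partial_STS_attained n :
  exists2 S : {set {set 'I_n}}, partial_STS S & #|S| = max_partial_STS n.
Proof.
have S0 : partial_STS (set0 : {set {set 'I_n}}).
  apply/andP; split; first exact: sub0set.
  apply/forallP => x; apply/forallP => y; apply/implyP => _.
  by rewrite (_ : [set B in _ | _] = set0) ?cards0 //; apply/setP => B; rewrite !inE.
have [|S S_STS maxS] := @eq_bigmax_cond _
  [pred S : {set {set 'I_n}} | partial_STS S] (fun S => #|S|).
  by apply/card_gt0P; exists set0.
by exists S => //; exact: esym maxS.
Qed.

(** * Coloring lines and blocks *)

Section BlockColoring.

Variables (n : nat) (L Bs : {set {set 'I_n}}).
Implicit Types (e f g b l : {set 'I_n}) (x y z t : 'I_n).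
Hypotheses (L_STS : partial_STS L).
Hypothesis block_eq : forall b b' x y, b \in Bs -> b' \in Bs -> x != y ->
  x \in b -> y \in b -> x \in b' -> y \in b' -> b = b'.
Hypothesis line_in_block : forall l b x y, l \in L -> b \in Bs -> x != y ->
  x \in l -> y \in l -> x \in b -> y \in b -> l \subset b.

Definition block_coloring (e : {set 'I_n}) : {set 'I_n} :=
  if e \in L then e
  else if [pick b in Bs | e \subset b] is Some b then b else set0.

Variant kind_spec e : {set 'I_n} -> Prop :=
| KindLine of e \in L : kind_spec e e
| KindBlock b of b \in Bs & e \subset b : kind_spec e b
| KindNone of (forall b, b \in Bs -> ~~ (e \subset b)) : kind_spec e set0.

Lemma kindP e : kind_spec e (block_coloring e).
Proof.
rewrite /block_coloring; case: ifP => [eL|_]; first exact: KindLine.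
case: pickP => [b /andP[bB eb]|none]; first exact: KindBlock.
by apply: KindNone => b bB; have := none b; rewrite bB /= => ->.
Qed.

(** Each two of the triples on four vertices share a pair, so they cannot be
    two different lines, nor lie in two different blocks.  If one is a line and
    another lies in a block, that block contains the line and hence all four
    vertices, so no triple is left uncovered. *)
Lemma block_coloring_free : F4_free block_coloring.
Proof.
pose share (e f : {set 'I_n}) := exists x y,
  x != y /\ [/\ x \in e, y \in e, x \in f & y \in f].
have shareC e f : share e f -> share f e.
  by move=> [x [y [xy [xe ye xf yf]]]]; exists x, y.
have line_line e f : e \in L -> f \in L -> share e f -> e = f.
  move=> eL fL [x [y [xy [xe ye xf yf]]]].
  exact: (partial_STS_eq L_STS eL fL xy).
have block_block e f b b' : b \in Bs -> b' \in Bs -> e \subset b -> f \subset b' ->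
    share e f -> b = b'.
  move=> bB b'B /subsetP eb /subsetP fb' [x [y [xy [xe ye xf yf]]]].
  by apply: (block_eq bB b'B xy); auto.
have all_kinds e f g b : e \in L -> b \in Bs -> f \subset b -> share e f ->
    g \subset e :|: f -> g \subset b.
  move=> eL bB fb [x [y [xy [xe ye xf yf]]]] /subset_trans; apply.
  rewrite subUset fb andbT; apply: (line_in_block eL bB xy) => //; exact: (subsetP fb).
have main e f g : share e f -> share e g -> share f g -> g \subset e :|: f ->
    f \subset e :|: g -> e \subset f :|: g ->
    ~~ uniq [:: block_coloring e; block_coloring f; block_coloring g]; last first.
  move=> x y z t /uniq4P[[xy xz xt] yz yt zt]; apply: main.
  - by exists x, y; rewrite !inE !eqxx ?orbT.
  - by exists y, z; rewrite !inE !eqxx ?orbT.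
  - by exists y, t; rewrite !inE !eqxx ?orbT.
  - by rewrite !subUset !sub1set !inE !eqxx ?orbT.
  - by rewrite !subUset !sub1set !inE !eqxx ?orbT.
  by rewrite !subUset !sub1set !inE !eqxx ?orbT.
move=> ef eg fg sub_g sub_f sub_e.
have same (a b d : {set 'I_n}) : [\/ a = b, a = d | b = d] -> ~~ uniq [:: a; b; d].
  by case=> ->; rewrite /= !inE eqxx ?orbT ?andbF.
case: (kindP e) => [eL|b bB eb|e0]; case: (kindP f) => [fL|b' b'B fb|f0];
  case: (kindP g) => [gL|b'' b''B gb|g0]; apply: same.
all: try by [constructor 1 | constructor 2 | constructor 3].
all: try by [constructor 1; exact: line_line | constructor 2; exact: line_line
            |constructor 3; exact: line_line].
all: try by [constructor 1; exact: (block_block e f)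
            |constructor 2; exact: (block_block e g)
            |constructor 3; exact: (block_block f g)].
all: exfalso.
- by case/negP: (g0 b' b'B); exact: (all_kinds e f).
- by case/negP: (f0 b'' b''B); exact: (all_kinds e g).
- by case/negP: (g0 b bB); apply: (all_kinds f e) => //; [exact: shareC|rewrite setUC].
- by case/negP: (f0 b bB); apply: (all_kinds g e) => //; [exact: shareC|rewrite setUC].
- by case/negP: (e0 b'' b''B); exact: (all_kinds f g).
- by case/negP: (e0 b' b'B); apply: (all_kinds g f) => //; [exact: shareC|rewrite setUC].
Qed.

End BlockColoring.

(** The case without blocks; since [n >= 4], some triple is not in the system,
    and it adds the color [set0]. *)
Lemma ar_F4_ge_STS n : 4 <= n -> max_partial_STS n + 1 <= ar_F4 n.
Proof.
move=> n4; have [S S_STS <-] := max_partial_STS_attained n.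
have := @ar_F4_ge n _ (block_coloring S set0) (ltnW n4) _.
have free : F4_free (block_coloring S set0).
  by apply: block_coloring_free => // [b b' x y|l b x y _]; rewrite inE.
move=> /(_ free); apply: leq_trans.
have S_triples : S \subset triples n by case/andP: S_STS.
suff /subset_leq_card : set0 |: S \subset block_coloring S set0 @: triples n.
  apply: leq_trans; rewrite cardsU1 addnC leq_add2r lt0b.
  by apply/negP => /(subsetP S_triples); rewrite inE cards0.
rewrite subUset sub1set; apply/andP; split; last first.
  apply/subsetP => e eS; apply/imsetP; exists e; first exact: (subsetP S_triples).
  by rewrite /block_coloring eS.
suff [e eT eS] : exists2 e, e \in triples n & e \notin S.
  apply/imsetP; exists e => //; case: kindP => // [eS'|b]; last by rewrite inE.
  by rewrite eS' in eS.
have i k : k < 4 -> k < n by move=> k4; exact: leq_trans n4.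
pose v k (k4 : k < 4) : 'I_n := Ordinal (i k k4).
pose x := v 0 isT; pose y := v 1 isT; pose z := v 2 isT; pose t := v 3 isT.
have [xyzS|xyzS] := boolP ([set x; y; z] \in S); last first.
  by exists [set x; y; z]; rewrite ?mem_triples.
have [xytS|xytS] := boolP ([set x; y; t] \in S); last first.
  by exists [set x; y; t]; rewrite ?mem_triples.
have /setP/(_ z) : [set x; y; z] = [set x; y; t].
  by apply: (@partial_STS_eq _ S _ _ x y); rewrite ?inE ?eqxx ?orbT.
by rewrite !inE.
Qed.

Lemma max_partial_STS_le n : 6 * max_partial_STS n <= n * n.-1.
Proof.
have [S S_STS <-] := max_partial_STS_attained n; have [S3 one] := andP S_STS.
have pairs e : e \in S -> \sum_(x in e) \sum_(y in e) (x != y) = 6.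
  move=> /(subsetP S3); rewrite inE => /eqP e3.
  transitivity (\sum_(x in e) 2); last by rewrite sum_nat_const e3.
  apply: eq_bigr => x xe; rewrite (bigD1 x) //= eqxx add0n.
  rewrite (eq_bigr (fun=> 1)) => [|y /andP[_ /negPf]]; last by rewrite eq_sym => ->.
  have := cardsD1 x e; rewrite xe e3 add1n => -[->]; rewrite sum1_card.
  by apply: eq_card => y; rewrite !inE andbC.
rewrite mulnC -sum_nat_const -(eq_bigr _ pairs).
have -> : n * n.-1 = \sum_(x < n) \sum_(y < n) (x != y).
  rewrite -[n in LHS]card_ord -sum_nat_const; apply: eq_bigr => x _.
  rewrite (bigD1 x) //= eqxx add0n (eq_bigr (fun=> 1)) => [|y /negPf].
    by rewrite sum1_card cardC1 card_ord.
  by rewrite eq_sym => ->.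
have -> : \sum_(e in S) \sum_(x in e) \sum_(y in e) (x != y) =
    \sum_(x < n) \sum_(y < n) \sum_(e in S | (x \in e) && (y \in e)) (x != y).
  under eq_bigr => e _ do rewrite big_mkcond.
  rewrite exchange_big; apply: eq_bigr => x _.
  under eq_bigr => e _ do [rewrite (big_mkcond (fun y => y \in e))].
  under [RHS]eq_bigr => y _ do rewrite big_mkcondr.
  rewrite [RHS]exchange_big; apply: eq_bigr => e _.
  by case: (x \in e) => //=; rewrite big1.
apply: leq_sum => x _; apply: leq_sum => y _.
have [->|xy] := eqVneq x y; first by rewrite big1.
rewrite sum1dep_card; have := implyP (forallP (forallP one x) y) xy.
by apply: leq_trans; rewrite cardsE.
Qed.

(** * Packings of Fano planes *)

(** The lines of the Fano plane are the translates of the perfect difference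
    set [{0, 1, 3}] modulo 7. *)
Definition fano_rel (k i : nat) : bool := (i + 7 - k) %% 7 \in [:: 0; 1; 3].

Definition fano_line (k : 'I_7) : {set 'I_7} := [set i : 'I_7 | fano_rel k i].

Lemma card_fano_line k : #|fano_line k| = 3.
Proof.
rewrite cardsE cardE size_filter -(count_map val (fano_rel k)).
rewrite (_ : Finite.enum _ = enum 'I_7) ?val_enum_ord; last by rewrite enumT.
by case: k; do 7?[case=> //].
Qed.

Lemma fano_line_eq i j k l : i != j -> i \in fano_line k -> j \in fano_line k ->
  i \in fano_line l -> j \in fano_line l -> k = l.
Proof.
have check : all (fun i => all (fun j => all (fun k => all (fun l =>
    [&& i != j, fano_rel k i, fano_rel k j, fano_rel l i & fano_rel l j] ==> (k == l))
    (iota 0 7)) (iota 0 7)) (iota 0 7)) (iota 0 7) by vm_compute.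
have mem7 (p : 'I_7) : val p \in iota 0 7 by rewrite mem_iota /= add0n.
move=> ij; rewrite !inE => ki kj li lj; apply/val_inj/eqP.
have /allP/(_ _ (mem7 j))/allP/(_ _ (mem7 k))/allP/(_ _ (mem7 l)) := allP check _ (mem7 i).
by rewrite (inj_eq val_inj) ij ki kj li lj.
Qed.

Definition nonline : {set 'I_7} := [set i : 'I_7 | i < 3].

Lemma card_nonline : #|nonline| = 3.
Proof.
rewrite cardsE cardE size_filter -(count_map val (fun i => i < 3)).
by rewrite (_ : Finite.enum _ = enum 'I_7) ?val_enum_ord; last by rewrite enumT.
Qed.

Lemma nonlineP k : nonline != fano_line k.
Proof.
apply/eqP => /setP E; have := E (Ordinal (isT : 0 < 7)).
have := E (Ordinal (isT : 1 < 7)); have := E (Ordinal (isT : 2 < 7)).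
by rewrite !inE; case: k {E}; do 7?[case=> //].
Qed.

(** The indices [i'] and [j'] are not assumed to agree with [i] and [j]: the
    images of two different blocks meet in at most one point. *)
Definition packing (I V : finType) (f : I -> 'I_7 -> V) : Prop :=
  (forall u, injective (f u)) /\
  (forall u v i j i' j', i != j -> f u i = f v i' -> f u j = f v j' -> u = v).

Section Packing.

Variables (n : nat) (I : finType) (f : I -> 'I_7 -> 'I_n).
Hypothesis pack : packing f.

Let injf u : injective (f u). Proof. by case: pack. Qed.

Definition pline (p : I * 'I_7) : {set 'I_n} := f p.1 @: fano_line p.2.
Definition pblock (u : I) : {set 'I_n} := f u @: [set: 'I_7].
Definition plines : {set {set 'I_n}} := pline @: [set: I * 'I_7].
Definition pblocks : {set {set 'I_n}} := pblock @: [set: I].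

Lemma in_two_images u v (A A' : {set 'I_7}) x y : x != y ->
  x \in f u @: A -> y \in f u @: A -> x \in f v @: A' -> y \in f v @: A' ->
  u = v /\ exists i j, [/\ i != j, i \in A, j \in A, i \in A' & j \in A'].
Proof.
move=> xy /imsetP[i iA Ex] /imsetP[j jA Ey] /imsetP[i' iA' Ex'] /imsetP[j' jA' Ey'].
have ij : i != j by apply: contra_neq xy => ij; rewrite Ex Ey ij.
have uv : u = v by apply: (pack.2 u v i j i' j'); rewrite -?Ex -?Ey.
rewrite -uv in Ex' Ey'; split=> //; exists i, j.
by rewrite (injf (etrans (esym Ex) Ex')) (injf (etrans (esym Ey) Ey')) in ij iA jA *.
Qed.

Lemma pline_eq p q x y : x != y -> x \in pline p -> y \in pline p ->
  x \in pline q -> y \in pline q -> p = q.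
Proof.
case: p q => [u k] [v l] xy xp yp xq yq.
have [/= -> [i [j [ij ik jk il jl]]]] := in_two_images xy xp yp xq yq.
by rewrite (fano_line_eq ij ik jk il jl).
Qed.

Lemma card_pline p : #|pline p| = 3.
Proof. by rewrite card_imset ?card_fano_line. Qed.

Lemma pblock_eq u v x y : x != y -> x \in pblock u -> y \in pblock u ->
  x \in pblock v -> y \in pblock v -> u = v.
Proof. by move=> xy xu yu xv yv; case: (in_two_images xy xu yu xv yv). Qed.

Lemma card_pblock u : #|pblock u| = 7.
Proof. by rewrite card_imset // cardsT card_ord. Qed.

Lemma pline_sub_pblock p u x y : x != y -> x \in pline p -> y \in pline p ->
  x \in pblock u -> y \in pblock u -> pline p \subset pblock u.
Proof.
by move=> xy xp yp xu yu; have [<- _] := in_two_images xy xp yp xu yu; rewrite imsetS ?subsetT.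
Qed.

Lemma two_points (A : {set 'I_n}) : 1 < #|A| -> exists x y, [/\ x != y, x \in A & y \in A].
Proof. by case/card_gt1P => x [y [xA yA xy]]; exists x, y. Qed.

Lemma plines_STS : partial_STS plines.
Proof.
apply/andP; split.
  by apply/subsetP => _ /imsetP[p _ ->]; rewrite inE card_pline.
apply/forallP => x; apply/forallP => y; apply/implyP => xy.
apply/card_le1_eqP => e e'; rewrite !inE => /andP[/imsetP[p _ ->] /andP[xp yp]].
by case/andP => /imsetP[q _ ->] /andP[xq yq]; rewrite (pline_eq xy xp yp xq yq).
Qed.

Lemma card_plines : #|plines| = 7 * #|I|.
Proof.
rewrite card_imset ?cardsT ?card_prod ?card_ord 1?mulnC // => p q pq.
have [x [y [xy xp yp]]] : exists x y, [/\ x != y, x \in pline p & y \in pline p].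
  by apply: two_points; rewrite card_pline.
by apply: (pline_eq xy xp yp); rewrite -pq.
Qed.

Lemma card_pblocks : #|pblocks| = #|I|.
Proof.
rewrite card_imset ?cardsT // => u v uv.
have [x [y [xy xu yu]]] : exists x y, [/\ x != y, x \in pblock u & y \in pblock u].
  by apply: two_points; rewrite card_pblock.
by apply: (pblock_eq xy xu yu); rewrite -uv.
Qed.

Lemma max_partial_STS_ge_packing : 7 * #|I| <= max_partial_STS n.
Proof.
rewrite -card_plines.
exact: (@leq_bigmax_cond _ (@partial_STS n) (fun S => #|S|) plines plines_STS).
Qed.

(** Every line and every block is itself a color; the latter is used because
    each block contains the triple [nonline]. *)
Lemma ar_F4_ge_packing : 3 <= n -> 8 * #|I| <= ar_F4 n.
Proof.
move=> n3; pose c := block_coloring plines pblocks.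
have free : F4_free c.
  apply: block_coloring_free; first exact: plines_STS.
    move=> b b' x y /imsetP[u _ ->] /imsetP[v _ ->] xy xu yu xv yv.
    by rewrite (pblock_eq xy xu yu xv yv).
  move=> l b x y /imsetP[p _ ->] /imsetP[u _ ->]; exact: pline_sub_pblock.
apply: leq_trans (ar_F4_ge n3 free).
have -> : 8 * #|I| = #|plines :|: pblocks|.
  rewrite cardsU (_ : plines :&: pblocks = set0) ?cards0 ?card_plines ?card_pblocks; last first.
    apply/setP => e; rewrite inE in_set0; apply/andP => -[/imsetP[p _ ->] /imsetP[u _ E]].
    by have := card_pline p; rewrite E card_pblock.
  lia.
have STS := plines_STS; have /andP[tri _] := STS.
apply/subset_leq_card/subsetP => e /setUP[eL|/imsetP[u _ ->]].
  apply/imsetP; exists e; first exact: (subsetP tri).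
  by rewrite /c /block_coloring eL.
have t3 : #|f u @: nonline| = 3 by rewrite card_imset ?card_nonline.
have tb : f u @: nonline \subset pblock u by rewrite imsetS ?subsetT.
have [x [y [xy xt yt]]] : exists x y, [/\ x != y, x \in f u @: nonline & y \in f u @: nonline].
  by apply: two_points; rewrite t3.
apply/imsetP; exists (f u @: nonline); first by rewrite inE t3.
rewrite /c; case: kindP => [/imsetP[[v k] _ E]|b /imsetP[v _ ->] sub|none].
- have := xt; have := yt; rewrite E => yl xl.
  have [uv _] := in_two_images xy xt yt xl yl.
  move: E; rewrite /pline -uv /= => /(imset_inj (@injf u)) E.
  by have := nonlineP k; rewrite E eqxx.
- have [xu yu] := (subsetP tb x xt, subsetP tb y yt).
  by rewrite (pblock_eq xy xu yu (subsetP sub x xt) (subsetP sub y yt)).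
by have := none (pblock u); rewrite tb imset_f // => /(_ isT).
Qed.

End Packing.

(** The blocks [i |-> a + b * i] modulo [N] cover every two points in different
    groups exactly once; the pairs inside a group are left to the packing [f]. *)
Section TransversalDesign.

Variables (N : nat) (I : finType) (f : I -> 'I_7 -> 'I_N).
Hypotheses (pack : packing f) (N0 : 0 < N) (coN : coprime N 60).

Definition td_point (k : nat) : 'I_N := Ordinal (ltn_pmod k N0).

Definition td (w : 'I_N * 'I_N + 'I_7 * I) (i : 'I_7) : 'I_7 * 'I_N :=
  match w with
  | inl (a, b) => (i, td_point (a + b * i))
  | inr (j, u) => (j, f u i)
  end.

(** The differences [j - i], at most 6 in absolute value, divide 60 and so are
    invertible modulo [N]. *)
Lemma td_slope (b b' : 'I_N) (a a' i j : nat) : i < 7 -> j < 7 -> i != j ->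
  a + b * i = a' + b' * i %[mod N] -> a + b * j = a' + b' * j %[mod N] -> b = b'.
Proof.
have diff d : 0 < d < 7 -> coprime d N.
  move=> d7; rewrite coprime_sym; apply: coprime_dvdr coN.
  by case: d d7 => [|[|[|[|[|[|[|d]]]]]]].
wlog lt_ij : i j / i < j.
  move=> H i7 j7 ij ei ej; have := ij; rewrite neq_ltn => /orP[lt|lt].
    exact: (H i j).
  by apply: (H j i); rewrite // eq_sym.
wlog le_bb : a a' b b' / b <= b'.
  move=> H i7 j7 ij ei ej; case: (leqP b b') => [|/ltnW] le; first exact: (H a a').
  by apply/esym/(H a' a).
move=> i7 j7 _ ei ej.
have /eqP : (a + b * i) + (a' + b' * j) = (a' + b' * i) + (a + b * j) %[mod N].
  by rewrite -[LHS]modnDm ei -ej modnDm.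
have -> : (a + b * i) + (a' + b' * j) = a + a' + b * i + b' * i + b' * (j - i).
  by rewrite -{1}(subnKC (ltnW lt_ij)) mulnDr; lia.
have -> : (a' + b' * i) + (a + b * j) = a + a' + b * i + b' * i + b * (j - i).
  by rewrite -{1}(subnKC (ltnW lt_ij)) mulnDr; lia.
rewrite eqn_modDl eqn_mod_dvd ?leq_mul2r ?le_bb ?orbT // -mulnBl Gauss_dvdl; last first.
  by rewrite coprime_sym diff // subn_gt0 lt_ij; lia.
move=> dvd; apply/val_inj/eqP; rewrite eqn_leq le_bb -subn_eq0 /=.
apply: contraTT dvd; rewrite -lt0n => bb; rewrite gtnNdvd //.
by apply: leq_ltn_trans (leq_subr _ _) (ltn_ord b').
Qed.

Lemma td_packing : packing td.
Proof.
split=> [[[a b]|[j u]] i i'|].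
- by case.
- by case=> /(pack.1 u).
move=> [[a b]|[k u]] [[a' b']|[k' u']] i j i' j' ij.
- case=> <- ei [<-] ej; have bb := td_slope (ltn_ord i) (ltn_ord j) ij ei ej.
  move: ei; rewrite bb => /eqP; rewrite eqn_modDr !modn_small ?ltn_ord // => /eqP aa.
  by rewrite (val_inj aa).
- by case=> ik _ [jk]; rewrite ik jk eqxx in ij.
- move=> [ki Ei] [kj Ej]; case/eqP: ij; apply: (pack.1 u).
  by apply/val_inj; rewrite Ei Ej -ki -kj.
by case=> -> ei [ej]; rewrite (pack.2 _ _ _ _ _ _ ij ei ej).
Qed.

End TransversalDesign.

Lemma packing_comp (I V W : finType) (f : I -> 'I_7 -> V) (g : V -> W) :
  injective g -> packing f -> packing (fun u i => g (f u i)).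
Proof.
move=> injg [injf eqf]; split=> [u i j /injg/injf //|u v i j i' j' ij /injg ei /injg ej].
exact: (eqf u v i j i' j').
Qed.

(** The recursion takes [N = 1] modulo 60 as large as possible with
    [7 * N <= n], leaving out [r <= 419] points.  This step loses
    [14 * N * r + r ^ 2 <= 3 * 419 * n <= 1260 * n], and since the seven groups
    together have at most [n] points, so does each of the [s] levels. *)
Lemma exists_packing s n : n < 2 ^ s ->
  exists (I : finType) (f : I -> 'I_7 -> 'I_n),
    packing f /\ n ^ 2 <= 42 * #|I| + 1260 * n * s.
Proof.
elim: s n => [|s IH] n lt_n.
  exists void, (fun u : void => match u with end); split; first by split; case.
  by case: n lt_n.
have [small|large] := leqP n 1260.
  exists void, (fun u : void => match u with end); split; first by split; case.
  by rewrite card_void muln0 add0n mulnS mulnC -mulnn; nia.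
pose q := (n %/ 7).-1 %/ 60; pose N := q * 60 + 1.
have Nn : 7 * N <= n by rewrite /N /q; lia.
have nN : n <= 7 * N + 419 by rewrite /N /q; lia.
have [|I [f [pack bound]]] := IH N; first by rewrite expnS in lt_n; lia.
have N0 : 0 < N by rewrite /N addn1.
have coN : coprime N 60 by rewrite /N coprime_sym /coprime gcdnMDl.
have lt_pt : #|{: 'I_7 * 'I_N}| <= n by rewrite card_prod !card_ord.
pose g (p : 'I_7 * 'I_N) : 'I_n := widen_ord lt_pt (enum_rank p).
have injg : injective g by move=> p p' /(congr1 val)/= /val_inj/enum_rank_inj.
exists _, (fun u i => g (td f N0 u i)); split.
  exact: packing_comp injg (td_packing pack N0 coN).
rewrite card_sum !card_prod !card_ord.
move: (#|I|) bound => m bound; clear -bound Nn nN.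
have [r [En r_le]] : exists r, n = 7 * N + r /\ r <= 419.
  by exists (n - 7 * N); lia.
rewrite -!mulnn in bound *; rewrite {}En; nia.
Qed.

From mathcomp Require Import all_order all_algebra.
From mathcomp Require Import all_classical all_reals all_analysis lra.
Import Order.TTheory GRing.Theory Num.Theory.
Import numFieldNormedType.Exports.
Local Open Scope classical_set_scope.
Local Open Scope ring_scope.

(** * The asymptotic statement *)

Lemma sqr_le_pow2 s : (s ^ 2 <= 2 * (2 ^ s - 1))%N.
Proof.
elim: s => // s IH; have lt_s := ltn_expl s (isT : (1 < 2)%N).
by rewrite (expnS 2); move: (2 ^ s)%N IH lt_s => p; rewrite -!mulnn; nia.
Qed.

(** As [s ^ 2 <= 2 * n] for [n = 2 ^ s - 1], the bound [C * n * s] is at most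
    [eps * n ^ 2] once [2 * C <= eps * s]. *)
Lemma littleo_pow2_sqr (R : realType) (e : nat -> R) (C : R) : 0 <= C ->
  (forall s, `|e s| <= C * (2 ^ s - 1)%N%:R * s%:R) ->
  e =o_\oo (fun s : nat => (2 ^ s - 1)%N%:R ^+ 2 : R).
Proof.
move=> C0 bound; apply/eqoP => eps eps0.
near=> s.
apply: le_trans (bound s) _; rewrite ger0_norm ?sqr_ge0 //.
have N0 : 0 <= (2 ^ s - 1)%N%:R :> R by [].
have sN : s%:R ^+ 2 <= 2 * (2 ^ s - 1)%N%:R :> R.
  by rewrite -natrX -natrM ler_nat sqr_le_pow2.
have large : 2 * C / eps <= s%:R by near: s; exact: nbhs_infty_ger.
rewrite ler_pdivrMr // in large.
rewrite expr2 mulrA -mulrAC ler_wpM2r //.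
move: (s%:R : R) (ler0n R s) large sN => x x0 large sN.
move: N0 sN; set N := _%:R; nra.
Unshelve. all: by end_near. Qed.

Theorem theorem1p8 (R : realType) :
  (forall n : nat, (4 <= n)%N ->
     (5 * n%:R ^+ 2 - 8 * n%:R) / 21 >= (ar_F4 n)%:R :> R /\
     (ar_F4 n >= max_partial_STS n + 1)%N) /\
  (exists e1 e2 : nat -> R,
     [/\ e1 =o_\oo (fun s : nat => (2 ^ s - 1)%N%:R ^+ 2 : R),
         e2 =o_\oo (fun s : nat => (2 ^ s - 1)%N%:R ^+ 2 : R) &
         forall s n : nat, (3 <= s)%N -> n = (2 ^ s - 1)%N ->
           (ar_F4 n)%:R >= (max_partial_STS n)%:R + n%:R ^+ 2 / 42 + e1 s /\
           (max_partial_STS n)%:R + n%:R ^+ 2 / 42 + e1 s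
             = 4 / 21 * n%:R ^+ 2 + e2 s]).
Proof.
split=> [n n4|].
  split; last exact: ar_F4_ge_STS.
  have upper : (21 * ar_F4 n + 8 * n <= 5 * n ^ 2)%N.
    by have := ar_F4_upper (ltnW n4); rewrite -mulnn; nia.
  rewrite ler_pdivlMr //; move: upper.
  by rewrite -(ler_nat R) natrD !natrM ?natrX; lra.
pose N s : nat := (2 ^ s - 1)%N; pose m s := max_partial_STS (N s).
pose err s : R := 240 * (N s)%:R * s%:R.
have m_le s : (m s)%:R <= (N s)%:R ^+ 2 / 6 :> R.
  have : (6 * m s <= N s ^ 2)%N.
    by apply: leq_trans (max_partial_STS_le (N s)) _; rewrite -mulnn leq_mul2l leq_pred orbT.
  by rewrite ler_pdivlMr // -(ler_nat R) natrM ?natrX; lra.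
have lower s : exists q : nat, [/\ (7 * q <= m s)%N, (3 <= N s)%N -> (8 * q <= ar_F4 (N s))%N &
    (N s)%:R ^+ 2 <= 42 * q%:R + 1260 * (N s)%:R * s%:R :> R].
  have [|I [f [pack bound]]] := @exists_packing s (N s).
    by rewrite /N subn1 prednK // expn_gt0.
  exists #|I|; split; first exact: max_partial_STS_ge_packing pack.
    exact: ar_F4_ge_packing pack.
  by move: bound; rewrite -(ler_nat R) natrD !natrM ?natrX.
(* With [q] blocks, [42 * q] falls short of [N s ^ 2] by [1260 * N s * s] at
   most; this costs 8/42 of it for the [8 * q] colors, hence the 240 in [err],
   and 7/42 of it, hence 210, for the [7 * q] triples; below, 450 = 240 + 210. *)
exists (fun s => - err s), (fun s => (m s)%:R - (N s)%:R ^+ 2 / 6 - err s).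
have Ns0 s : 0 <= (N s)%:R * s%:R :> R by rewrite mulr_ge0.
split.
- apply: (littleo_pow2_sqr (ler0n R 240)) => s.
  rewrite normrN ger0_norm; first exact: lexx.
  by rewrite /err -mulrA; exact: mulr_ge0 (ler0n R 240) (Ns0 s).
- apply: (littleo_pow2_sqr (ler0n R 450)) => s.
  have [q [mq _ Nq]] := lower s; have := m_le s; have := Ns0 s.
  move: mq; rewrite -(ler_nat R) natrM ler_norml /err -!mulrA in Nq *.
  by move=> ? ? ?; apply/andP; split; lra.
move=> s n s3 -> {n}; rewrite -/(N s) -/(m s); split; last by lra.
have [q [_ arq Nq]] := lower s; have := m_le s; have := Ns0 s.
have N3 : (3 <= N s)%N.
  have : (2 ^ 3 <= 2 ^ s)%N by rewrite leq_exp2l.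
  by rewrite /N; lia.
move: (arq N3); rewrite -(ler_nat R) natrM /err -!mulrA in Nq *; lra.
Qed.
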